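(* Let $k\ge 3$ be an odd integer and let $n\ge 8k$ be an integer. Then $\tilde{r}(C_k,C_n)\le 3n+\log_2 n+50k$.
   Context: The online Ramsey game is played between Builder and Painter on the infinite complete graph $K_{\mathbb N}$. In each round Builder selects a previously unselected edge of $K_{\mathbb N}$ and Painter colors it red or blue. For finite graphs $G_1,G_2$, the game ends as soon as the graph formed by all colored edges contains a red copy of $G_1$ or a blue copy of $G_2$; Builder wants to end the game as soon as possible and Painter wants to delay the end. The online Ramsey number $\tilde{r}(G_1,G_2)$ is the minimum number of rounds within which Builder can guarantee the end of the game, both players playing optimally. $C_k$ denotes the cycle on $k$ vertices. *)

(* Defs.v *)
From mathcomp Require Import all_boot all_order all_algebra.
From mathcomp Require Import all_classical all_reals all_analysis.

Set Implicit Arguments.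
Unset Strict Implicit.
Unset Printing Implicit Defensive.

(* Finite simple graphs. *)
Record sgraph := SGraph {
  vertex :> finType;
  edge : rel vertex;
  edge_sym : symmetric edge;
  edge_irr : irreflexive edge
}.

(* [ordS] is the successor modulo [k]. The conjunct [i != j] only matters for
   [k = 1], where [ordS] fixes the unique vertex. *)
Definition cycle_edge (k : nat) : rel 'I_k :=
  fun i j => (i != j) && ((j == ordS i) || (i == ordS j)).

Lemma cycle_edge_sym k : symmetric (@cycle_edge k).
Proof. by move=> i j; rewrite /cycle_edge eq_sym orbC. Qed.

Lemma cycle_edge_irr k : irreflexive (@cycle_edge k).
Proof. by move=> i; rewrite /cycle_edge eqxx. Qed.

Definition cycle_graph (k : nat) : sgraph :=
  SGraph (@cycle_edge_sym k) (@cycle_edge_irr k).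

(* Edges of the complete graph on nat: the edge joining u and v is represented
   by the pair of its endpoints in increasing order. *)
Definition KNedge := {e : nat * nat | e.1 < e.2}.

Definition color := bool.
Definition red : color := true.
Definition blue : color := false.

(* The edges selected so far with their colors, most recent first. *)
Definition history := seq (KNedge * color).

Definition colored_adj (h : history) (c : color) (u v : nat) : bool :=
  has (fun ec => (ec.2 == c) &&
         ((val ec.1 == (u, v)) || (val ec.1 == (v, u)))) h.

(* Copies are subgraphs, not necessarily induced. *)
Definition has_copy (G : sgraph) (h : history) (c : color) : Prop :=
  exists f : G -> nat, injective f /\
    forall x y : G, edge x y -> colored_adj h c (f x) (f y).

Definition game_over (G1 G2 : sgraph) (h : history) : Prop :=
  has_copy G1 h red \/ has_copy G2 h blue.

Definition builder := history -> KNedge.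
Definition painter := history -> KNedge -> color.

Definition legal_builder (b : builder) : Prop :=
  forall h : history, b h \notin unzip1 h.

(* The history after [m] rounds. Play formally continues after the end of the
   game; this is harmless since [game_over] is preserved by further rounds. *)
Fixpoint play (b : builder) (p : painter) (m : nat) : history :=
  if m is m'.+1 then
    let h := play b p m' in (b h, p h (b h)) :: h
  else [::].

Definition builder_ends_within (G1 G2 : sgraph) (r : nat) : Prop :=
  exists b : builder, legal_builder b /\
    forall p : painter, exists2 m, m <= r & game_over G1 G2 (play b p m).

(* [r] is the online Ramsey number of [(G1, G2)]. *)
Definition is_online_ramsey (G1 G2 : sgraph) (r : nat) : Prop :=
  builder_ends_within G1 G2 r /\
  forall r' : nat, builder_ends_within G1 G2 r' -> r <= r'.

Definition log2 (R : realType) (x : R) : R := (ln x / ln 2)%R.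

(* Main.v *)
Require Import Defs.
From mathcomp Require Import all_boot all_order all_algebra zify.
From mathcomp Require Import all_classical all_reals all_analysis.

Set Implicit Arguments.
Unset Strict Implicit.
Unset Printing Implicit Defensive.

Import Order.TTheory GRing.Theory Num.Theory.

(* Put [k = 2 h + 3]. Builder grows blue paths by testing edges from new
   vertices to the ends of the paths, and waits for a triangle: a red edge [b c]
   with a common blue neighbour [a].

   A blue path with [n + 3 h + 6] vertices and a disjoint triangle win in [O(k)]
   rounds. Testing the short chords of a middle part along two [k]-cycles yields
   two versions of it whose lengths differ by 1. Now edges between a front part
   and a back part of the path close a blue [C_n] unless they form a red zigzag.
   If [b] and [c] send no suitable pairs of blue edges to the two parts, closing
   a blue [C_n] through [b], [c] or [b a c], then they close a red [C_k] with
   the zigzag. In the same way, a triangle joins two blue paths into one.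

   With two triangles, a blue, a red and a blue path in a row absorb any new
   vertex in three rounds, so only the two triangles have to be found cheaply.
   They come from a vertex joined in red to the ends of two blue paths. If the
   ends are joined in red, then the zigzag between the paths gives a triangle or
   a red [C_k]. If they are joined in blue, or if a blue path with [n] vertices
   does not close, then some vertex sees both colours on a blue path; bisection
   finds a triangle there, splitting the path, and is the source of [log2 n].
   A new vertex costs one round for the first path and two rounds for the second
   one. The second path is never split while there is no triangle, so that the
   rounds spent are always accounted for by the vertices of the remaining paths:
   a vertex of the shorter path is worth one round and a vertex of the longer
   one two rounds, and after the second triangle every vertex is worth three. *)

(** * Histories and winning positions *)

Lemma colored_adj_sym h c u v : colored_adj h c u v = colored_adj h c v u.
Proof. by apply: eq_has => e; rewrite orbC. Qed.

Definition extends (h h' : history) : Prop :=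
  forall c u v, colored_adj h c u v -> colored_adj h' c u v.

Lemma extends_refl h : extends h h. Proof. by []. Qed.

Lemma extends_trans h1 h2 h3 : extends h1 h2 -> extends h2 h3 -> extends h1 h3.
Proof. by move=> h12 h23 c u v /h12/h23. Qed.

Lemma extends_cons h e : extends h (e :: h).
Proof. by move=> c u v; rewrite /colored_adj /= => ->; rewrite orbT. Qed.

Lemma cycle_has_copy h c s : 0 < size s -> uniq s ->
  cycle (colored_adj h c) s -> has_copy (cycle_graph (size s)) h c.
Proof.
case: s => // x p _ us cyc.
have adjS (i j : 'I_(size p).+1) : j = ordS i ->
  colored_adj h c (nth 0 (x :: p) i) (nth 0 (x :: p) j).
  move=> ->; move: cyc => /= /(pathP 0) /(_ i).
  rewrite size_rcons ltn_ord => /(_ isT).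
  rewrite -rcons_cons nth_rcons ltn_ord /= nth_rcons.
  have [lt_ip|ge_ip] := ltnP i (size p); first by rewrite modn_small.
  have -> : (i : nat) = size p by have := ltn_ord i; lia.
  by rewrite eqxx modnn.
exists (fun i : 'I_(size p).+1 => nth 0 (x :: p) i); split.
  by move=> i j /eqP; rewrite nth_uniq // => /eqP/val_inj.
move=> i j /andP[_ /orP[/eqP|/eqP]] /adjS //.
by rewrite colored_adj_sym.
Qed.

(** A backward recursion on positions, with no strategy function in it. [winning_builder] turns it
    into a [builder]. *)
Fixpoint winning (G1 G2 : sgraph) (r : nat) (h : history) : Prop :=
  game_over G1 G2 h \/
  if r is r'.+1 then
    exists2 e, e \notin unzip1 h & forall c, winning G1 G2 r' ((e, c) :: h)
  else False.

Lemma winningS G1 G2 r h : winning G1 G2 r h -> winning G1 G2 r.+1 h.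
Proof.
elim: r h => [|r IH] h; first by case=> // over; left.
case=> [over|[e he H]]; first by left.
by right; exists e => [|c] //; apply: IH (H c).
Qed.

Lemma winning_leq G1 G2 r r' h :
  r <= r' -> winning G1 G2 r h -> winning G1 G2 r' h.
Proof.
by move/subnK<-; elim: (r' - r) => // d IH /IH; rewrite addSn; apply: winningS.
Qed.

(** Either the edge is new and can be selected, or a colour of [u v] is known already: this is what
    makes repeated tests free. *)
Lemma mem_KNedge (h : history) (u v : nat) : u != v ->
  exists2 e : KNedge, (e \in unzip1 h ->
      colored_adj h red u v \/ colored_adj h blue u v) &
    forall c h', colored_adj ((e, c) :: h') c u v.
Proof.
wlog lt_uv : u v / u < v.
  move=> IH neq_uv; have [lt_uv|] := ltnP u v; first exact: IH.
  rewrite leq_eqVlt eq_sym (negPf neq_uv) /= => lt_vu.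
  have [|e H1 H2] := IH _ _ lt_vu; first by rewrite eq_sym.
  exists e; first by rewrite !(colored_adj_sym h _ u v).
  by move=> c h1; have := H2 c h1; rewrite [colored_adj _ _ v u]colored_adj_sym.
move=> _; exists (exist (fun e : nat * nat => e.1 < e.2) (u, v) lt_uv); last first.
  by move=> c h'; rewrite /colored_adj /= !eqxx.
move=> /mapP[[e c] he /= def_e].
suff: colored_adj h c u v by case: c {he} => hc; [left|right].
by apply/hasP; exists (e, c) => //=; rewrite -def_e !eqxx.
Qed.

(** * Rounds and strategies *)

Section Forcing.

Variables k n : nat.

Definition wins (r : nat) (h : history) : Prop :=
  winning (cycle_graph k) (cycle_graph n) r h.

(* Within [c] rounds Builder can win or reach a position satisfying [Phi]. The
   quantification over extensions of [h] makes room for edges that happen to be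
   coloured already: testing such an edge costs nothing. *)
Variant forces (c : nat) (h : history) (Phi : history -> Prop) : Prop :=
  Forces of forall h' r, extends h h' ->
    (forall h'', extends h' h'' -> Phi h'' -> wins r h'') -> wins (c + r) h'.

Lemma forces_ret c h (Phi : history -> Prop) :
  (forall h', extends h h' -> Phi h') -> forces c h Phi.
Proof.
move=> H; split=> h' r e K; apply: (@winning_leq _ _ r); first by lia.
exact: (K _ (@extends_refl _) (H _ e)).
Qed.

Lemma forces_weaken c c' h (Phi Psi : history -> Prop) : c <= c' ->
  (forall h', extends h h' -> Phi h' -> Psi h') ->
  forces c h Phi -> forces c' h Psi.
Proof.
move=> le_c PP [F]; split=> h' r e K; apply: (@winning_leq _ _ (c + r)); first by lia.
by apply: F => // h'' e' /(PP _ (extends_trans e e')); apply: K.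
Qed.

Lemma forces_bind c1 c2 h (Phi Psi : history -> Prop) :
  forces c1 h Phi ->
  (forall h', extends h h' -> Phi h' -> forces c2 h' Psi) ->
  forces (c1 + c2) h Psi.
Proof.
move=> [F1] F2; split=> h' r e K; rewrite -addnA; apply: F1 => // h'' e' P.
have [F2'] := F2 _ (extends_trans e e') P; apply: F2' => //.
by move=> h3 e3; apply: K; apply: extends_trans e' e3.
Qed.

Lemma forces_seq c1 c2 c h (Phi Psi : history -> Prop) :
  forces c1 h Phi -> c1 + c2 <= c ->
  (forall h', extends h h' -> Phi h' -> forces c2 h' Psi) ->
  forces c h Psi.
Proof.
by move=> F1 le_c F2; apply: (forces_weaken le_c) (forces_bind F1 F2).
Qed.

Lemma forces_test h (u v : nat) : u != v ->
  forces 1 h (fun h' => colored_adj h' red u v \/ colored_adj h' blue u v).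
Proof.
move=> neq_uv; split=> h' r _ K.
have [e He Hc] := mem_KNedge h' neq_uv.
have [/He col|e_new] := boolP (e \in unzip1 h').
  by apply: winningS; apply: K.
right => /=; exists e => // c; apply: K; first exact: extends_cons.
by case: c (Hc c h') => ?; [left|right].
Qed.

Definition rd (h : history) : rel nat := colored_adj h red.
Definition bl (h : history) : rel nat := colored_adj h blue.

Lemma rdC h u v : rd h u v = rd h v u. Proof. exact: colored_adj_sym. Qed.
Lemma blC h u v : bl h u v = bl h v u. Proof. exact: colored_adj_sym. Qed.
Lemma rd_ext h h' u v : extends h h' -> rd h u v -> rd h' u v.
Proof. by move=> e /e. Qed.
Lemma bl_ext h h' u v : extends h h' -> bl h u v -> bl h' u v.
Proof. by move=> e /e. Qed.

Lemma forces_if h (u v : nat) c (Psi : history -> Prop) : u != v ->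
  (forall h', extends h h' -> rd h' u v -> forces c h' Psi) ->
  (forall h', extends h h' -> bl h' u v -> forces c h' Psi) ->
  forces c.+1 h Psi.
Proof.
move=> neq_uv Fr Fb; apply: (forces_seq (c2 := c) (forces_test h neq_uv)) => //.
by move=> h' e [] col; [apply: Fr|apply: Fb].
Qed.

(** The game is over, so any [Psi] may be claimed. In the lemmas below, [forces c h Psi] for an
    arbitrary [Psi] says that Builder wins within [c] rounds. *)
Lemma forces_red_cycle c h Psi s : 0 < k -> size s = k -> uniq s ->
  cycle (rd h) s -> forces c h Psi.
Proof.
move=> k0 ss us cyc; split=> h' r e _.
suff over: game_over (cycle_graph k) (cycle_graph n) h'.
  by apply: (@winning_leq _ _ 0) => //; left.
left; rewrite -ss; apply: cycle_has_copy; rewrite ?ss //.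
by apply: sub_cycle cyc => u v; apply: e.
Qed.

Lemma forces_blue_cycle c h Psi s : 0 < n -> size s = n -> uniq s ->
  cycle (bl h) s -> forces c h Psi.
Proof.
move=> k0 ss us cyc; split=> h' r e _.
suff over: game_over (cycle_graph k) (cycle_graph n) h'.
  by apply: (@winning_leq _ _ 0) => //; left.
right; rewrite -ss; apply: cycle_has_copy; rewrite ?ss //.
by apply: sub_cycle cyc => u v; apply: e.
Qed.

Lemma forces_scan h (L : seq (nat * nat)) : all (fun e => e.1 != e.2) L ->
  forces (size L) h (fun h' => all (fun e => rd h' e.1 e.2) L \/
    exists L1 e L2, [/\ L = L1 ++ e :: L2, all (fun e => rd h' e.1 e.2) L1
      & bl h' e.1 e.2]).
Proof.
elim: L h => [|e L IH] h /=; first by move=> _; apply: forces_ret; left.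
case/andP=> ne allne; apply: (forces_if ne) => h1 e1 col; last first.
  by apply: forces_ret => h2 e2; right; exists [::], e, L; rewrite (bl_ext e2 col).
apply: forces_weaken (IH h1 allne) => // h2 e2; have col2 := rd_ext e2 col.
case=> [->|[L1 [e' [L2 [-> H1 H2]]]]]; first by rewrite col2; left.
by right; exists (e :: L1), e', L2; rewrite /= col2 H1.
Qed.

Lemma forces_reveal h (L : seq (nat * nat)) : all (fun e => e.1 != e.2) L ->
  forces (size L) h (fun h' => forall e, e \in L -> rd h' e.1 e.2 \/ bl h' e.1 e.2).
Proof.
elim: L h => [|e L IH] h /=; first by move=> _; apply: forces_ret.
case/andP=> ne allne.
apply: (forces_seq (c2 := size L) (forces_test h ne)) => // h1 e1 col.
apply: forces_weaken (IH h1 allne) => // h2 e2 H2 e'.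
rewrite inE => /orP[/eqP->|/H2 //].
by case: col => [/(rd_ext e2)|/(bl_ext e2)]; [left|right].
Qed.

End Forcing.

(** * Disjointness by counting multiplicities *)

Lemma uniq_countP (s : seq nat) :
  reflect (forall x, count_mem x s <= 1) (uniq s).
Proof.
apply: (iffP idP) => [us x|H]; first by rewrite count_uniq_mem // leq_b1.
apply: count_mem_uniq => x; have := H x.
have := has_pred1 x s; rewrite has_count; lia.
Qed.

Definition msub (s t : seq nat) : Prop :=
  forall x, count_mem x s <= count_mem x t.

Lemma perm_countP (s t : seq nat) :
  (forall x, count_mem x s = count_mem x t) -> perm_eq s t.
Proof. by move=> H; apply/allP => x _; apply/eqP/H. Qed.

Lemma msub_subset (s t : seq nat) : uniq s -> {subset s <= t} -> msub s t.
Proof.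
move=> us st x; rewrite count_uniq_mem //; case: (boolP (x \in s)) => // /st.
by rewrite -has_pred1 has_count.
Qed.

Ltac cnt_norm := repeat progress (rewrite /= -?cats1 ?count_cat ?count_rev).
Ltac cnt_atoms z :=
  repeat match goal with
  | |- context [nat_of_bool (@eq_op ?T ?x z)] => generalize (nat_of_bool (@eq_op T x z)); intro
  | |- context [nat_of_bool (@eq_op ?T z ?x)] => rewrite (eq_sym z x)
  end.
(** Goals and hypotheses on [uniq], [msub] and [perm_eq] become, for one arbitrary vertex [z],
    linear inequalities between multiplicities. *)
Ltac uq_goal z :=
  repeat match goal with
  | H : is_true (@uniq _ _) |- _ => move/uniq_countP/(_ z): H
  | H : msub _ _ |- _ => move/(_ z): H
  | H : @eq (list _) _ _ |- _ => move/(congr1 (count_mem z)): H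
  | H : is_true (@perm_eq _ _ _) |- _ => move/permP/(_ (pred1 z)): H
  end; cnt_norm; cnt_atoms z; clear; lia.
Ltac uq := let z := fresh "z" in
  first [apply/uniq_countP => z | move=> z | apply: perm_countP => z];  uq_goal z.

Lemma uniq_neq (s : seq nat) x y : uniq s -> msub [:: x; y] s -> x != y.
Proof.
move=> us /(_ x); move/uniq_countP/(_ x): us => /=; rewrite eqxx.
by case: (y =P x) => [->|/eqP]; rewrite ?eqxx //; [lia | rewrite eq_sym].
Qed.

Lemma path_bl_ext h h' x s : extends h h' -> path (bl h) x s -> path (bl h') x s.
Proof. by move=> e; apply: sub_path => u v; apply: e. Qed.

Lemma path_rd_ext h h' x s : extends h h' -> path (rd h) x s -> path (rd h') x s.
Proof. by move=> e; apply: sub_path => u v; apply: e. Qed.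

Lemma sorted_bl_ext h h' s : extends h h' -> sorted (bl h) s -> sorted (bl h') s.
Proof. by case: s => //= x s; apply: path_bl_ext. Qed.

Lemma sorted_rd_ext h h' s : extends h h' -> sorted (rd h) s -> sorted (rd h') s.
Proof. by case: s => //= x s; apply: path_rd_ext. Qed.

Lemma sorted_adj_rev h c s :
  sorted (colored_adj h c) (rev s) = sorted (colored_adj h c) s.
Proof.
by rewrite rev_sorted; apply: eq_sorted => u v; rewrite colored_adj_sym.
Qed.

Lemma sorted_cat_cons (T : Type) (e : rel T) s x t :
  sorted e (s ++ x :: t) = sorted e (rcons s x) && path e x t.
Proof.
by case: s => [|y s] //=; rewrite cat_path rcons_path /= andbA.
Qed.

Ltac push_ext e :=
  repeat match type of e with extends ?h _ =>
  match goal with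
  | H : is_true (rd h _ _) |- _ => move/(rd_ext e): H => H
  | H : is_true (bl h _ _) |- _ => move/(bl_ext e): H => H
  | H : is_true (path (rd h) _ _) |- _ => move/(path_rd_ext e): H => H
  | H : is_true (path (bl h) _ _) |- _ => move/(path_bl_ext e): H => H
  | H : is_true (sorted (rd h) _) |- _ => move/(sorted_rd_ext e): H => H
  | H : is_true (sorted (bl h) _) |- _ => move/(sorted_bl_ext e): H => H
  end end.

(* The red edge [b c] with its common blue neighbour [a]: a blue path may enter
   and leave at [b] and [c] in any way, using one or three vertices. *)
Definition tri (h : history) (a b c : nat) : bool :=
  [&& bl h a b, bl h a c & rd h b c].

Lemma tri_ext h h' a b c : extends h h' -> tri h a b c -> tri h' a b c.
Proof.
by move=> e /and3P[H1 H2 H3]; rewrite /tri (bl_ext e H1) (bl_ext e H2) (rd_ext e H3).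
Qed.

Definition tril (h : history) (T : seq nat) : bool :=
  if T is [:: a; b; d] then tri h a b d else false.

Lemma tril_ext h h' T : extends h h' -> tril h T -> tril h' T.
Proof. by case: T => [|a [|b [|d []]]] //=; apply: tri_ext. Qed.

(** What splitting leaves of the vertices [s]; [m] bounds the number of vertices lost from the
    paths, the triangle included. *)
Definition pieces (m : nat) (s : seq nat) (h : history) : Prop :=
  exists T A B, [/\ tril h T, sorted (bl h) A, sorted (bl h) B,
    msub (T ++ A ++ B) s & size s <= size A + size B + m].

Ltac cnt z := cnt_norm; cnt_atoms z; clear; lia.

Ltac nq := match goal with H : is_true (@uniq _ ?s) |- is_true (?x != ?y) =>
  apply: (uniq_neq H); uq end.

(** * Finding triangles *)

Section Splitting.


Variables hf n : nat.
Local Notation k := (2 * hf + 3).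
Local Notation forces := (forces k n).

(** Binary search for a colour change at [w]: the colour of the middle edge decides which half still
    starts blue and ends red. *)
Lemma forces_bisect c h (w x : nat) p : uniq (w :: x :: p) ->
    bl h w x -> rd h w (last x p) -> 0 < size p <= 2 ^ c ->
  forces c h (fun h' => exists p1 a b p2,
    [/\ x :: p = p1 ++ [:: a, b & p2], bl h' w a & rd h' w b]).
Proof.
elim: c h x p => [|c IH] h x p up wx wl /andP[p0 pc].
  case: p {up} wl pc p0 => [|b [|? ?]] //= wb _ _; apply: forces_ret => h' e.
  by exists [::], x, b, [::]; rewrite (bl_ext e wx) (rd_ext e wb).
have [p1|p2] := leqP (size p) 1.
  case: p {up} wl p1 p0 {pc} => [|b [|? ?]] //= wb _ _; apply: forces_ret => h' e.
  by exists [::], x, b, [::]; rewrite (bl_ext e wx) (rd_ext e wb).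
have [m [m0 ltm m1 m2]] : exists m,
    [/\ 0 < m, m < size p, m <= 2 ^ c & size p - m <= 2 ^ c].
  by rewrite expnS in pc; exists (size p %/ 2); split; lia.
have Em : size (take m p) = m by rewrite size_takel // ltnW.
have Ed : size (drop m p) = size p - m by rewrite size_drop.
case Et : (take m p) Em => [|y q] Em; first by rewrite -Em in m0.
have Ep : p = (y :: q) ++ drop m p by rewrite -Et cat_take_drop.
set z := last y q; set d := drop m p in Ep Ed.
have Ez : y :: q = rcons (belast y q) z by rewrite -lastI.
have wz : w != z.
  by move: up; rewrite Ep Ez => up; nq.
apply: (forces_if wz) => h1 e col; push_ext e.
- apply: forces_weaken (IH h1 x (y :: q) _ wx col _) => //.
  + move=> h2 e2 [p1 [a [b [p3 [E H1 H2]]]]].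
    by exists p1, a, b, (p3 ++ d); rewrite Ep -cat_cons E -catA.
  + by move: up; rewrite Ep => up; uq.
  + by rewrite Em m0.
- apply: forces_weaken (IH h1 z d _ col _ _) => //.
  + move=> h2 e2 [p1 [a [b [p3 [E H1 H2]]]]].
    exists (x :: belast y q ++ p1), a, b, p3.
    by rewrite Ep Ez cat_rcons E /= -catA.
  + by move: up; rewrite Ep Ez => up; uq.
  + by move: wl; rewrite Ep Ez cat_rcons last_cat /=.
  + by rewrite Ed subn_gt0 ltm.
Qed.

(** Bisection gives neighbours [a], [b] on the path with [w a] blue and [w b] red; as [a b] is blue,
    [a], [w], [b] form a triangle, and only these three vertices are lost. *)
Lemma forces_split c h (w x : nat) p z : uniq (w :: x :: p) ->
    sorted (bl h) (w :: x :: p) -> z \in p -> rd h w z -> size p <= 2 ^ c ->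
  forces c h (pieces 3 (w :: x :: p)).
Proof.
move=> up sp zp wz pc; case/splitPr: zp up sp pc => p1 p2 up sp pc.
have /= /andP[wx sx] := sp.
apply: forces_weaken (forces_bisect (c := c) (p := rcons p1 z) _ wx _ _) => //.
- move=> h1 e [q1 [a [b [q2 [E H1 H2]]]]].
  have E2 : x :: p1 ++ z :: p2 = q1 ++ [:: a, b & q2 ++ p2].
    by rewrite -cat_rcons -[LHS]/((x :: rcons p1 z) ++ p2) E -catA.
  have sE : sorted (bl h) (q1 ++ [:: a, b & q2 ++ p2]) by rewrite -E2.
  rewrite E2; exists [:: a; w; b], q1, (q2 ++ p2); push_ext e.
  rewrite /tril /tri [bl h1 a w]blC H1 H2 /= andbT.
  move: sE; rewrite sorted_cat_cons => /andP[/= s1 /andP[ab s2]].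
  split=> //.
  + by move: s1; rewrite -cats1 => /cat_sorted2[].
  + exact: path_sorted s2.
  + by uq.
  + by rewrite /= !size_cat /= !size_cat; clear; lia.
- by uq.
- by rewrite last_rcons.
- by rewrite size_rcons /=; move: pc; rewrite size_cat /=; lia.
Qed.

(** After [x] and [y] the list continues the zigzag [x y a1 b1 a2 b2 ...] between two paths. *)
Fixpoint zz (A B : seq nat) : seq nat :=
  match A, B with a :: A', b :: B' => a :: b :: zz A' B' | _, _ => [::] end.

(** The last red zigzag edge, the next path edge and the next zigzag edge span three vertices. So
    the first blue zigzag edge and the blue path edge give a common blue neighbour of a red edge. *)
Lemma forces_zz h (x y : nat) A B : uniq (x :: y :: A ++ B) -> size A = size B ->
    path (bl h) x A -> path (bl h) y B -> rd h x y ->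
  forces (2 * size A) h (fun h' => path (rd h') x (y :: zz A B) \/
    exists a b d, tri h' a b d /\ msub [:: a; b; d] (x :: y :: A ++ B)).
Proof.
elim: A B h x y => [|a A IH] [|b B] h x y // us sAB pA pB xy.
  by apply: forces_ret => h' e; left => /=; rewrite (rd_ext e xy).
rewrite /= in pA pB; case/andP: pA => xa pA; case/andP: pB => yb pB.
have ne1 : y != a by nq.
rewrite /= mulnS add2n; apply: (forces_if ne1) => h1 e1 c1; push_ext e1; last first.
  apply: forces_ret => h2 e2; push_ext e2; right; exists a, x, y.
  by rewrite /tri blC xa blC c1 xy; split=> //; uq.
have ne2 : a != b by nq.
apply: (forces_if ne2) => h2 e2 c2; push_ext e2; last first.
  apply: forces_ret => h3 e3; push_ext e3; right; exists b, y, a.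
  by rewrite /tri blC yb blC c2 c1; split=> //; uq.
apply: forces_weaken (IH B h2 a b _ _ pA pB c2) => //; last by case: sAB.
- move=> h3 e3; push_ext e3; case=> [H|[a' [b' [d' [H1 H2]]]]].
    by left; rewrite /= xy c1.
  by right; exists a', b', d'; split=> //; move=> z; have := H2 z; cnt z.
- by uq.
Qed.

Lemma size_zz A B : size A = size B -> size (zz A B) = 2 * size A.
Proof. elim: A B => [|a A IH] [|b B] //= [/IH->]; lia. Qed.

Lemma count_zz A B z : size A = size B ->
  count_mem z (zz A B) = count_mem z A + count_mem z B.
Proof. by elim: A B => [|a A IH] [|b B] //= [/IH->]; cnt z. Qed.

Lemma last_zz y A B : size A = size B -> last y (zz A B) = last y B.
Proof. by elim: A B y => [|a A IH] [|b B] //= y [/IH]. Qed.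

(* If all zigzag edges are red, then [v], the zigzag from [x] to the end of
   its tail and the edge back to [y] form a red [C_k]. *)
Lemma forces_zigzag h (v x y : nat) A B : uniq (v :: x :: y :: A ++ B) ->
    size A = hf -> size B = hf -> path (bl h) x A -> path (bl h) y B ->
    rd h v x -> rd h v y -> rd h x y ->
  forces (3 * hf + 1) h (fun h' =>
    exists a b d, tri h' a b d /\ msub [:: a; b; d] (x :: y :: A ++ B)).
Proof.
move=> us sA sB pA pB vx vy xy.
(* Started at [y], the zigzag runs [y x b1 a1 ...] and ends at the last vertex of [A]. *)
have yx : rd h y x by rewrite rdC.
have sBA : size B = size A by rewrite sA.
have uyx : uniq (y :: x :: B ++ A) by uq.
apply: (forces_seq (c2 := hf.+1) (forces_zz uyx sBA pB pA yx)); first by rewrite sB; clear; lia.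
move=> h1 e1; push_ext e1; case=> [/= /andP[_ pz]|[a [b [d [H1 H2]]]]]; last first.
  apply: forces_ret => h2 e2; exists a, b, d; rewrite (tri_ext e2) //; split=> //.
  by move=> z; have := H2 z; cnt z.
have lz := last_zz x sBA.
have fin h2 : extends h1 h2 -> rd h2 (last x A) y -> forall c Psi, forces c h2 Psi.
  move=> e2 ly c Psi; push_ext e2.
  apply: (@forces_red_cycle _ _ c _ _ (v :: x :: rcons (zz B A) y)).
  - by clear; lia.
  - by rewrite /= size_rcons size_zz // sB; clear; lia.
  - apply/uniq_countP => z; rewrite -cats1; move/uniq_countP/(_ z): us.
    cnt_norm; rewrite count_zz //; cnt z.
  - by rewrite /= vx -!cats1 -catA cat_path pz /= lz ly rdC vy.
(* For [hf = 0] the last vertex of [x :: A] is [x] itself, and the closing edge is already red. *)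
case EA : A (lz) => [|a A'].
  by move=> _; apply: fin => //; rewrite EA /= rdC.
rewrite -EA => _; have ly : y != last x A.
  by rewrite EA /=; move: us; rewrite EA [a :: A']lastI => us; nq.
(* If the closing edge is blue, [y] sees blue at the last vertex of [A] and red at [x]: bisection
   along the reversed path finds a triangle. The crude bound [hf <= 2 ^ hf] is enough here. *)
apply: (forces_if ly) => h2 e2 c2; push_ext e2.
  by apply: fin => //; rewrite rdC.
have sz : 0 < size (behead (rev (x :: A))) <= 2 ^ hf.
  by rewrite size_behead size_rev /= sA -{1}sA EA /= ltnW // ltn_expl.
have Er : rev (x :: A) = last x A :: behead (rev (x :: A)).
  by rewrite lastI rev_rcons.
have lr : last (last x A) (behead (rev (x :: A))) = x.
  by rewrite -[X in X = _]/(last 0 (_ :: behead (rev (x :: A)))) -Er rev_cons last_rcons.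
apply: forces_weaken (forces_bisect (c := hf) (w := y) _ c2 _ sz) => //.
- move=> h3 e3 [p1 [a1 [b1 [p2 [E H1 H2]]]]]; push_ext e3.
  have E' : x :: A = rev p2 ++ [:: b1, a1 & rev p1].
    by rewrite -[LHS]revK Er E rev_cat !rev_cons -!cats1 -!catA.
  exists a1, y, b1; rewrite /tri blC H1 H2 /= andbT.
  have := pA; rewrite -[path _ _ _]/(sorted (bl h3) (x :: A)) E' sorted_cat_cons.
  move=> /andP[_ /= /andP[ba _]]; rewrite blC; split=> // z.
  have := congr1 (count_mem z) E'; cnt z.
- rewrite -Er; uq.
- by rewrite lr.
Qed.

(* The triangle comes from the [hf + 1] vertices of each path next to [v]; the
   rest of both paths survives. *)
Lemma forces_zigzag_pieces h (v x y : nat) P Q : uniq (v :: x :: y :: P ++ Q) ->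
    hf <= size P -> hf <= size Q -> path (bl h) x P -> path (bl h) y Q ->
    rd h v x -> rd h v y -> rd h x y ->
  forces (3 * hf + 1) h (fun h' => exists T A B, [/\ tril h' T,
    sorted (bl h') A, sorted (bl h') B, msub (T ++ A ++ B) (x :: P ++ y :: Q) &
    size P <= size A + hf /\ size Q <= size B + hf]).
Proof.
move=> us sP sQ pP pQ vx vy xy.
have EP := cat_take_drop hf P; have EQ := cat_take_drop hf Q.
set A := take hf P in EP; set B := take hf Q in EQ.
have sA : size A = hf by rewrite /A size_takel.
have sB : size B = hf by rewrite /B size_takel.
rewrite -EP in us pP *; rewrite -EQ in us pQ *.
move: pP pQ; rewrite !cat_path => /andP[pA pP] /andP[pB pQ].
have uAB : uniq (v :: x :: y :: A ++ B) by uq.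
apply: forces_weaken (forces_zigzag uAB sA sB pA pB vx vy xy) => // h1 e.
case=> a [b [d [H1 H2]]]; push_ext e.
exists [:: a; b; d], (drop hf P), (drop hf Q); split=> //.
- exact: path_sorted pP.
- exact: path_sorted pQ.
- by move=> z; have := H2 z; cnt z.
- by rewrite !size_cat sA sB; clear; lia.
Qed.

End Splitting.

(** * A first blue path or triangle from fresh vertices *)

Section Feeding.

Variables hf n : nat.
Local Notation k := (2 * hf + 3).
Local Notation forces := (forces k n).

(** The Gerencser-Gyarfas argument: a red and a blue path leaving a common vertex [y] cover
    everything. If [v y] is red, the edge from [v] to the blue neighbour of [y] decides whether that
    neighbour or [v] becomes the common vertex; the other case is symmetric. *)
Lemma forces_gg_step h (v y : nat) zs us : uniq (v :: y :: zs ++ us) ->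
    path (rd h) y zs -> path (bl h) y us ->
  forces 2 h (fun h' => exists y' zs' us', [/\ path (rd h') y' zs',
    path (bl h') y' us' & perm_eq (y' :: zs' ++ us') (v :: y :: zs ++ us)]).
Proof.
move=> us_ pz pu; have vy : v != y by nq.
apply: (forces_if vy) => h1 e1 c1; push_ext e1.
- case: us us_ pu => [|u us] us_ pu.
    apply: forces_ret => h2 e2; push_ext e2; exists v, (y :: zs), [::].
    by rewrite /= c1; split=> //; uq.
  have vu : v != u by nq.
  apply: (forces_if (c := 0) vu) => h2 e2 c2; push_ext e2;
    apply: forces_ret => h3 e3; push_ext e3; move: pu => /= /andP[yu pu].
  + by exists u, [:: v, y & zs], us; rewrite /= c1 rdC c2; split=> //; uq.
  + by exists v, (y :: zs), (u :: us); rewrite /= c1 c2; split=> //; uq.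
- case: zs us_ pz => [|z zs] us_ pz.
    apply: forces_ret => h2 e2; push_ext e2; exists v, [::], (y :: us).
    by rewrite /= c1; split=> //; uq.
  have vz : v != z by nq.
  apply: (forces_if (c := 0) vz) => h2 e2 c2; push_ext e2;
    apply: forces_ret => h3 e3; push_ext e3; move: pz => /= /andP[yz pz].
  + by exists v, (z :: zs), (y :: us); rewrite /= c1 c2; split=> //; uq.
  + by exists z, zs, [:: v, y & us]; rewrite /= c1 blC c2; split=> //; uq.
Qed.

Lemma forces_gg h (F : seq nat) : uniq F -> 0 < size F ->
  forces (2 * size F) h (fun h' => exists y zs us, [/\ path (rd h') y zs,
    path (bl h') y us & perm_eq (y :: zs ++ us) F]).
Proof.
elim: F h => [|v F IH] h // uF _.
case: F IH uF => [|f F] IH uF.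
  by apply: forces_ret => h' e; exists v, [::], [::].
have uF' : uniq (f :: F) by uq.
apply: (forces_seq (c2 := 2) (IH h uF' isT)) => [|h1 e1 [y [zs [us [pz pu pF]]]]].
  by rewrite /= !mulnS; clear; lia.
have u1 : uniq (v :: y :: zs ++ us) by uq.
apply: forces_weaken (forces_gg_step u1 pz pu) => // h2 e2.
move=> [y' [zs' [us' [H1 H2 H3]]]]; exists y', zs', us'; split=> //; uq.
Qed.

(** Number the red path [z0, ..., zk]. If the chords [z0 z2], [z2 z4], ... are all blue, they form
    the blue path; a red one shortens the red path to [k] vertices. Then [z0 z(k-1)] red closes the
    first [k] vertices, [z0 zk] red closes the shortened path, and if both are blue, [z0] is the
    common blue neighbour of the red edge [z(k-1) zk]. *)
Lemma forces_red_path h (z : nat) zs : uniq (z :: zs) -> path (rd h) z zs ->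
    size zs = k ->
  forces (hf + 2) h (fun h' =>
    (exists P, [/\ sorted (bl h') P, size P = hf.+1 & msub P (z :: zs)]) \/
    exists a b d, tri h' a b d /\ msub [:: a; b; d] (z :: zs)).
Proof.
move=> uz pz sz; pose Z := z :: zs; have uZ : uniq Z by [].
have sZ : size Z = k.+1 by rewrite /= sz.
pose L := [seq (nth 0 Z (2 * i), nth 0 Z (2 * i + 2)) | i <- iota 0 hf].
have nZ i j : i < k.+1 -> j < k.+1 -> (nth 0 Z i == nth 0 Z j) = (i == j).
  by move=> li lj; rewrite nth_uniq ?sZ.
have neL : all (fun e => e.1 != e.2) L.
  apply/allP => e /mapP[i]; rewrite mem_iota => /andP[_ li] -> /=.
  by rewrite nZ; lia.
have sL : size L = hf by rewrite size_map size_iota.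
have F1 := forces_reveal k n h neL; rewrite sL in F1.
apply: (forces_seq F1 (leqnn _)) => h1 e1 H1; push_ext e1.
have [allb|] := boolP (all (fun e => bl h1 e.1 e.2) L).
  apply: forces_ret => h2 e2; left.
  exists [seq nth 0 Z (2 * i) | i <- iota 0 hf.+1]; split.
  - apply/(sortedP 0) => i; rewrite size_map size_iota => li.
    rewrite !(nth_map 0) ?size_iota // 1?ltnW // !nth_iota // 1?ltnW //.
    apply: (bl_ext e2); have /allP /(_ (nth 0 Z (2 * i), nth 0 Z (2 * i + 2))) := allb.
    rewrite !add0n mulnS [2 + _]addnC; apply; apply/mapP; exists i => //.
    by rewrite mem_iota /=; lia.
  - by rewrite size_map size_iota.
  - apply: msub_subset => [|e /mapP[i]]; last first.
      by rewrite mem_iota => /andP[_ li] ->; apply: mem_nth; rewrite sZ; lia.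
    rewrite map_inj_in_uniq ?iota_uniq // => i j.
    rewrite !mem_iota => /andP[_ li] /andP[_ lj] /eqP.
    by rewrite nZ; lia.
case/allPn => e eL nb; have {nb} : rd h1 e.1 e.2 by case: (H1 e eL) nb => // ->.
case/mapP: eL => i; rewrite mem_iota => /andP[_ li] -> /= ri.
have pZ := pathP 0 pz.
pose Z1 := take k Z.
have cyc1 : forall h2, extends h1 h2 -> rd h2 (nth 0 Z (2 * hf + 2)) z ->
    forall c Psi, forces c h2 Psi.
  move=> h2 e2 c2 c Psi; push_ext e2.
  have sZ1 : size (take (2 * hf + 2) zs) = (2 * hf + 2) by rewrite size_takel // sz; clear; lia.
  apply: (@forces_red_cycle _ _ c _ _ (z :: take (2 * hf + 2) zs)).
  - by clear; lia.
  - by rewrite /= sZ1; clear; lia.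
  - by apply: subseq_uniq uz; rewrite /= eqxx; apply: take_subseq.
  - rewrite /= rcons_path take_path // (last_nth 0) sZ1 /=.
    have -> // : nth 0 (z :: take (2 * hf + 2) zs) (2 * hf + 2) = nth 0 Z (2 * hf + 2).
    by rewrite [2 * hf + 2]addnS /= nth_take.
have ne1 : nth 0 Z (2 * hf + 2) != z by rewrite -[z]/(nth 0 Z 0) nZ; clear; lia.
apply: (forces_if (c := 1) ne1) => h2 e2 c2; push_ext e2; first exact: cyc1 c2 _ _.
have ne2 : nth 0 Z k != z by rewrite -[z]/(nth 0 Z 0) nZ; clear; lia.
apply: (forces_if (c := 0) ne2) => h3 e3 c3; push_ext e3; last first.
  apply: forces_ret => h4 e4; push_ext e4; right.
  exists z, (nth 0 Z (2 * hf + 2)), (nth 0 Z k).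
  have r1 : rd h4 (nth 0 Z (2 * hf + 2)) (nth 0 Z k).
    have := pathP 0 pz (2 * hf + 2); rewrite sz.
    have -> : nth 0 zs (2 * hf + 2) = nth 0 Z k by have -> : k = (2 * hf + 2).+1 by lia.
    by apply; clear; lia.
  rewrite /tri blC c2 blC c3 r1; split=> //.
  apply: msub_subset.
    rewrite /= !inE !negb_or eq_sym ne1 eq_sym ne2 /= andbT.
    by rewrite nZ; clear; lia.
  by apply/allP; rewrite /= mem_head !mem_nth ?sZ //; clear; lia.
(* the red chord shortens the red path from [z] to the last vertex *)
pose W := take (2 * i).+1 Z ++ drop (2 * i + 2) Z.
have EZ : Z = take (2 * i).+1 Z ++ nth 0 Z (2 * i).+1 :: drop (2 * i + 2) Z.
  by rewrite addn2 -drop_nth ?cat_take_drop // sZ; move: li; clear; lia.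
have sT : size (take (2 * i).+1 Z) = (2 * i).+1 by rewrite size_takel // sZ; move: li; clear; lia.
have sD : size (drop (2 * i + 2) Z) = k.+1 - (2 * i + 2) by rewrite size_drop sZ.
apply: (@forces_red_cycle _ _ _ _ _ W).
- by clear; lia.
- by rewrite size_cat sT sD; move: li; clear; lia.
- by rewrite /W; uq.
- have sW : sorted (rd h3) Z by [].
  rewrite EZ sorted_cat_cons in sW; case/andP: sW => sW1 sW2.
  have : path (rd h3) z (behead W ++ [:: z]); last first.
    by rewrite /W /= -cats1.
  rewrite /W /= -catA cat_path; apply/andP; split.
    by move: sW1; rewrite /= rcons_path => /andP[].
  have -> : last z (take (2 * i) zs) = nth 0 Z (2 * i).
    rewrite (last_nth 0) size_takel ?sz; last by move: li; clear; lia.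
    by case: (2 * i) => [|j] //=; rewrite nth_take.
  move: sW2 ri sD; rewrite (drop_nth 0); last by rewrite sZ; move: li; clear; lia.
  move=> /= /andP[_ sW2] -> sD /=.
  rewrite cat_path sW2 /= andbT (last_nth 0).
  have -> // : nth 0 (nth 0 Z (2 * i + 2) :: drop (2 * i + 2).+1 Z)
    (size (drop (2 * i + 2).+1 Z)) = nth 0 Z k.
  rewrite -drop_nth ?sZ; last by move: li; clear; lia.
  by rewrite nth_drop size_drop sZ; congr nth; move: li; clear; lia.
Qed.

(** If the blue branch is too short, it takes at most [hf] of the [3 * hf + 3] vertices together
    with the common vertex, which leaves at least [k] for the red branch. *)
Lemma forces_feed h (F : seq nat) : uniq F -> size F = 3 * hf.+1 ->
  forces (7 * hf + 8) h (fun h' =>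
    (exists P, [/\ sorted (bl h') P, hf < size P & msub P F]) \/
    exists a b d, tri h' a b d /\ msub [:: a; b; d] F).
Proof.
move=> uF sF; have F0 : 0 < size F by rewrite sF.
apply: (forces_seq (c2 := hf + 2) (forces_gg h uF F0)); first by rewrite sF; clear; lia.
move=> h1 e1 [y [zs [us [pz pu pF]]]].
have sE := perm_size pF; rewrite /= size_cat sF in sE.
have [ge_us|lt_us] := leqP hf (size us).
  apply: forces_ret => h2 e2; push_ext e2; left; exists (y :: us); split=> //.
  by uq.
have ge_zs : k <= size zs by lia.
have Ez := cat_take_drop k zs.
have uz : uniq (y :: take k zs) by uq.
have sub : msub (y :: take k zs) F by uq.
have pzk : path (rd h1) y (take k zs) by rewrite take_path.
have := forces_red_path uz pzk (size_takel ge_zs).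
apply: forces_weaken => // h2 e2 [[P [H1 H2 H3]]|[a [b [d [H1 H2]]]]].
  by left; exists P; split=> //; [rewrite H2 | uq].
by right; exists a, b, d; split=> //; uq.
Qed.

End Feeding.

(** * Absorbing vertices between two blue paths *)

Section Engine.

Variables hf n : nat.
Local Notation k := (2 * hf + 3).
Local Notation forces := (forces k n).

(* A blue path [x :: ps] and a blue path [y :: us] joined by a red path
   [y :: zs] ending in [x]; when [ps] is empty, [x] is just the end of the
   red path. *)
Record brb (h : history) (y : nat) (zs us ps : seq nat) : Prop := Brb {
  brb_red : path (rd h) y zs;
  brb_right : path (bl h) y us;
  brb_left : path (bl h) (last y zs) ps;
  brb_size : size zs <= 2 * hf + 1;
  brb_link : ps != [::] -> zs != [::] }.

(** Potential of the left path in an amortised count: a vertex is absorbed in three rounds plus the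
    decrease of [ne ps]. A step of four rounds must empty [ps], and a step that creates [ps] takes
    at most two. *)
Definition ne (s : seq nat) : nat := if s is [::] then 0 else 1.

Lemma brb_ext h h' y zs us ps : extends h h' -> brb h y zs us ps -> brb h' y zs us ps.
Proof. by move=> e [*]; push_ext e; split. Qed.

(** A synonym that the [uniq] patterns of [uq] and [nq] do not match, so that the section hypothesis
    is used only through explicit copies. *)
Definition Uq (s : seq nat) : Prop := uniq s.

Section Step.

Variables (h : history) (v y : nat) (zs us ps : seq nat) (D : nat).
Variable Psi : history -> Prop.
Hypothesis st : brb h y zs us ps.
Hypothesis us_ : Uq (v :: y :: zs ++ us ++ ps).
Hypothesis next : forall h' y' zs' us' ps', extends h h' ->
  brb h' y' zs' us' ps' ->
  perm_eq (y' :: zs' ++ us' ++ ps') (v :: y :: zs ++ us ++ ps) ->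
  forces (D + ne ps') h' Psi.

Lemma brb_next c h' y' zs' us' ps' : extends h h' -> brb h' y' zs' us' ps' ->
  perm_eq (y' :: zs' ++ us' ++ ps') (v :: y :: zs ++ us ++ ps) ->
  D + ne ps' <= c -> forces c h' Psi.
Proof.
by move=> e b p le_c; apply: forces_weaken (next e b p) => //.
Qed.

Let vy : v != y. Proof. have uall : uniq (v :: y :: zs ++ us ++ ps) := us_. by nq. Qed.

Lemma brb_step_nil : zs = [::] -> forces (D + 3) h Psi.
Proof.
have uall : uniq (v :: y :: zs ++ us ++ ps) := us_.
case: st => pz pu _ _ /=.
case Ep : ps => [|p ps'] // lk Ez; last by move: lk; rewrite Ez => /(_ isT).
rewrite [D + 3]addn3; apply: (forces_if vy) => h1 e1 c1; push_ext e1.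
- apply: (brb_next (y' := y) (zs' := [:: v]) (us' := us) (ps' := [::]) e1).
  + by split=> //=; [rewrite rdC c1|rewrite addn1].
  + by rewrite Ep Ez; uq.
  + by rewrite /=; clear; lia.
- apply: (brb_next (y' := v) (zs' := [::]) (us' := y :: us) (ps' := [::]) e1).
  + by split; rewrite //= ?c1.
  + by rewrite Ep Ez; uq.
  + by rewrite /=; clear; lia.
Qed.

(** The edge from [v] to the second vertex [z] of the red path decides: red makes [v] the junction,
    blue moves [y] and [v] to the right blue path and makes [z] the junction. *)
Lemma brb_step_blue z zs0 c h1 : zs = z :: zs0 -> extends h h1 -> bl h1 v y ->
  D + ne ps <= c -> forces c.+1 h1 Psi.
Proof.
have uall : uniq (v :: y :: zs ++ us ++ ps) := us_.
move=> Ez e1 c1 le_c; have [pz pu pp sz lk] := brb_ext e1 st.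
have vz : v != z by move: uall; rewrite Ez => u; nq.
apply: (forces_if vz) => h2 e2 c2; push_ext e2.
  apply: (brb_next (y' := v) (zs' := zs) (us' := y :: us) (ps' := ps)) => //.
  - exact: extends_trans e1 e2.
  - by split; rewrite //= ?Ez /= ?c2 ?c1 //; move: pz pp sz; rewrite Ez //= => /andP[].
  - by uq.
have e12 := extends_trans e1 e2.
(* With [zs0] empty the red path shrinks to [z], where the left path starts: all is one blue path,
   read from the far end of [ps] if there is one. *)
rewrite blC in c2; case E0 : zs0 => [|z1 zs1].
  case/lastP Er : ps => [|ps1 p].
    apply: (brb_next (y' := z) (zs' := [::]) (us' := [:: v, y & us]) (ps' := [::])) => //.
    + by split; rewrite //= ?c2 ?c1.
    + by rewrite Er Ez E0; uq.
    + by apply: leq_trans le_c; rewrite leq_add2l.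
  apply: (brb_next (y' := p) (zs' := [::])
    (us' := rev ps1 ++ [:: z, v, y & us]) (ps' := [::])) => //.
  + split=> //=.
    have : sorted (bl h2) (rev (rcons ps1 p) ++ [:: z, v, y & us]).
      rewrite sorted_cat_cons /= c2 c1 pu /= andbT.
      rewrite -rev_cons sorted_adj_rev -Er.
      by move: pp; rewrite Ez E0.
    by rewrite rev_rcons /=.
  + by rewrite Er Ez E0; uq.
  + by apply: leq_trans le_c; rewrite leq_add2l.
apply: (brb_next (y' := z) (zs' := zs0) (us' := [:: v, y & us]) (ps' := ps)) => //.
- split; rewrite //= ?E0 ?c2 ?c1 //.
  + by move: pz; rewrite Ez E0 /= => /andP[].
  + by move: pp; rewrite Ez E0.
  + by move: sz; rewrite Ez E0 /=; clear; lia.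
- by rewrite Ez; uq.
Qed.

(* The red path from [v] over [y] to [x] has [k - 1] edges: the edge [v x] is
   forced to be blue. *)
Lemma brb_step_full z zs0 h1 : zs = z :: zs0 -> extends h h1 -> rd h1 v y ->
  size zs = 2 * hf + 1 -> forces (D + 2 + ne ps) h1 Psi.
Proof.
have uall : uniq (v :: y :: zs ++ us ++ ps) := us_.
move=> Ez e1 c1 sz; have [pz pu pp _ lk] := brb_ext e1 st.
case/lastP Er : zs (Ez) => [|zs1 x] // _.
have lx : last y zs = x by rewrite Er last_rcons.
have vx : v != x by move: uall; rewrite Er => u; nq.
rewrite [D + 2]addn2 addSn; apply: (forces_if vx) => h2 e2 c2; push_ext e2.
  apply: (@forces_red_cycle _ _ _ _ _ [:: v, y & zs]).
  - by rewrite ?Ep ?Eps /=; clear; lia.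
  - by rewrite /= sz; clear; lia.
  - by uq.
  - by rewrite /= c1 rcons_path pz lx rdC.
have e12 := extends_trans e1 e2.
have szx : size zs1 = 2 * hf by move: sz; rewrite Er size_rcons; clear; lia.
have [Ep|np] := eqVneq ps [::].
  apply: (brb_next (y' := y) (zs' := zs) (us' := us) (ps' := [:: v])) => //.
  - by split; rewrite ?sz //= ?lx ?Ez // blC c2.
  - by rewrite Ep; uq.
  - by rewrite ?Ep ?Eps /=; clear; lia.
have [p0 [ps0 Eps]] : exists p0 ps0, ps = p0 :: ps0 by case: (ps) np => // p0 ps0 _; exists p0, ps0.
have pvx : path (bl h2) v (x :: ps) by rewrite /= c2 -lx.
case E1 : zs1 => [|z1 zs2].
  apply: (brb_next (y' := y) (zs' := [:: v]) (us' := us) (ps' := x :: ps)) => //.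
  - by split=> //=; [rewrite rdC c1|rewrite addn1].
  - by rewrite Er E1; uq.
  - by rewrite ?Ep ?Eps /=; clear; lia.
(* The vertex before [x] on the red path is tested against [v]. In either case [x] passes to the
   left blue path, so the red path does not grow. *)
have vw : v != last y zs1.
  by move: uall; rewrite Er E1 [z1 :: zs2]lastI last_rcons => u; nq.
rewrite addSn; apply: (forces_if vw) => h3 e3 c3; push_ext e3.
  apply: (brb_next (y' := y) (zs' := rcons zs1 v) (us' := us) (ps' := x :: ps)) => //.
  - exact: extends_trans e12 e3.
  - split=> //; rewrite ?last_rcons ?size_rcons ?szx ?addn1 //.
      by move: pz; rewrite Er !rcons_path => /andP[-> _]; rewrite rdC.
    by rewrite E1.
  - by rewrite Er; uq.
  - by rewrite ?Ep ?Eps /=; clear; lia.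
apply: (brb_next (y' := y) (zs' := zs1) (us' := us) (ps' := [:: v, x & ps])) => //.
- exact: extends_trans e12 e3.
- split=> //.
  + by move: pz; rewrite Er rcons_path => /andP[].
  + by apply/andP; split; [rewrite blC | exact: pvx].
  + by rewrite szx; clear; lia.
  + by rewrite E1.
- by rewrite Er; uq.
- by rewrite ?Ep ?Eps /=; clear; lia.
Qed.

(** Either [v] alone, or [v] preceded by its red neighbour [u] on the right path, is put in front of
    the red path. If the latter makes it too long, its [k] vertices force the edge between its ends
    to be blue. *)
Lemma brb_step_red z zs0 h1 : zs = z :: zs0 -> extends h h1 -> rd h1 v y ->
  size zs <= 2 * hf -> forces (D + 2 + ne ps) h1 Psi.
Proof.
have uall : uniq (v :: y :: zs ++ us ++ ps) := us_.
move=> Ez e1 c1 sz; have [pz pu pp _ lk] := brb_ext e1 st.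
have pyz : path (rd h1) v (y :: zs) by rewrite /= c1.
case Eu : us => [|u us0].
  apply: (brb_next (y' := v) (zs' := y :: zs) (us' := [::]) (ps' := ps)) => //.
  - by split=> //=; move: sz; clear; lia.
  - by rewrite Eu; uq.
  - by rewrite ?Ep ?Eps /=; clear; lia.
have vu : v != u by move: uall; rewrite Eu => uu; nq.
rewrite [D + 2]addn2 addSn; apply: (forces_if vu) => h2 e2 c2; push_ext e2; last first.
  have e12 := extends_trans e1 e2.
  apply: (brb_next (y' := v) (zs' := y :: zs) (us' := us) (ps' := ps)) => //.
  split=> //=; first by move: pu; rewrite Eu /= c2 => /andP[].
  by move: sz; clear; lia.
have e12 := extends_trans e1 e2.
have pu0 : path (bl h2) u us0 by move: pu; rewrite Eu => /andP[].
have pyz' : path (rd h2) u [:: v, y & zs] by rewrite /= rdC c2; exact: pyz.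
have [lt_sz|ge_sz] := ltnP (size zs) (2 * hf).
  apply: (brb_next (y' := u) (zs' := [:: v, y & zs]) (us' := us0) (ps' := ps)) => //.
  - by split=> //=; move: lt_sz; clear; lia.
  - by rewrite Eu; uq.
have Esz : size zs = 2 * hf by apply/eqP; rewrite eqn_leq sz.
case/lastP Er : zs (Ez) => [|zs1 x] // _.
have lx : last y zs = x by rewrite Er last_rcons.
have xu : x != u by move: uall; rewrite Er Eu => uu; nq.
rewrite addSn; apply: (forces_if xu) => h3 e3 c3; push_ext e3.
  apply: (@forces_red_cycle _ _ _ _ _ [:: u, v, y & zs]).
  - by rewrite ?Ep ?Eps /=; clear; lia.
  - by rewrite /= Esz; clear; lia.
  - by rewrite Eu in uall; uq.
  - by rewrite -[cycle _ _]/(path (rd h3) u (rcons [:: v, y & zs] u)) rcons_path pyz' /= lx.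
have e13 := extends_trans e12 e3.
(* With [x u] blue and no left path, the red path is reversed: [x] is the new junction and [v] the
   far end. *)
have [Ep|np] := eqVneq ps [::].
  apply: (brb_next (y' := x) (zs' := rev (y :: zs1) ++ [:: v]) (us' := us)
    (ps' := [::])) => //.
  - split=> //.
    + have : sorted (rd h3) (rev [:: v, y & zs]) by rewrite sorted_adj_rev.
      by rewrite Er -!rcons_cons rev_rcons /= rev_cons cats1.
    + by rewrite Eu /= c3.
    + move: Esz; rewrite Er size_rcons size_cat size_rev /=; clear; lia.
  - by rewrite Er Ep; uq.
  - by rewrite ?Ep ?Eps /=; clear; lia.
have [p0 [ps0 Eps]] : exists p0 ps0, ps = p0 :: ps0 by case: (ps) np => // p0 ps0 _; exists p0, ps0.
case/lastP Ep : ps np => [|ps1 e] // _.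
have sS : path (bl h3) e (rev ps1 ++ x :: us).
  have : sorted (bl h3) (rev ps ++ x :: us).
    rewrite sorted_cat_cons -rev_cons sorted_adj_rev Eu /= c3 pu0 /= andbT.
    by rewrite -lx.
  by rewrite Ep rev_rcons /=.
have pv1 : path (rd h3) v (y :: zs1).
  by move: pyz; rewrite Er -rcons_cons rcons_path => /andP[].
(* The edge [x u] has merged the two blue paths, and the red path [v y zs1] hangs free; a fourth
   test attaches it at the far end [e]. This round is paid for by [ne ps], as [ps] becomes empty. *)
have ve : v != e by move: uall; rewrite Ep => uu; nq.
have sz1 : size zs1 < 2 * hf by move: Esz; rewrite Er size_rcons; clear; lia.
have -> : D + ne (rcons ps1 e) = D.+1 by rewrite -Ep Eps /= addn1.
apply: (forces_if ve) => h4 e4 c4; push_ext e4.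
  apply: (brb_next (y' := e) (zs' := [:: v, y & zs1]) (us' := rev ps1 ++ x :: us)
    (ps' := [::])) => //.
  - exact: extends_trans e13 e4.
  - split=> //=; first by rewrite rdC c4.
    by move: sz1; clear; lia.
  - by rewrite Er Ep; uq.
  - by rewrite ?Ep ?Eps /=; clear; lia.
apply: (brb_next (y' := v) (zs' := y :: zs1) (us' := e :: rev ps1 ++ x :: us)
    (ps' := [::])) => //.
- exact: extends_trans e13 e4.
- split=> //=; first by rewrite c4.
  by move: sz1; clear; lia.
- by rewrite Er Ep; uq.
- by rewrite ?Ep ?Eps /=; clear; lia.
Qed.

Lemma brb_step : forces (D + 3 + ne ps) h Psi.
Proof.
case Ez : zs => [|z zs0].
  by apply: forces_weaken (brb_step_nil Ez) => //; clear; lia.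
have E3 : D + 3 + ne ps = (D + 2 + ne ps).+1 by clear; lia.
rewrite E3; apply: (forces_if vy) => h1 e1 c1.
  have [_ _ _ sz _] := st; have [lt_sz|ge_sz] := leqP (size zs) (2 * hf).
    exact: brb_step_red Ez e1 c1 lt_sz.
  by apply: brb_step_full Ez e1 c1 _; move: sz ge_sz; clear; lia.
have E2 : D + 2 + ne ps = (D + 1 + ne ps).+1 by clear; lia.
by rewrite E2; apply: brb_step_blue Ez e1 c1 _; clear; lia.
Qed.

End Step.

End Engine.

(** * Fresh vertices, chords of paths and index progressions *)

Lemma fresh (s : seq nat) : uniq s -> exists v, uniq (v :: s).
Proof.
move=> us; exists (sumn s).+1; rewrite /= us andbT.
apply/negP => /(nthP 0) [i li Ei].
have : nth 0 s i <= sumn s.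
  by elim: s i li {us Ei} => [|x s IH] [|i] //= li; [|have := IH _ li]; clear; lia.
by rewrite Ei ltnn.
Qed.

(** [nth 0 p j] has index [j.+1] in [x :: p], so the chord skips [j - i] vertices. *)
Lemma path_skip (e : rel nat) x p i j : i <= j -> j < size p -> path e x p ->
    e (nth 0 (x :: p) i) (nth 0 p j) ->
  [/\ path e x (take i p ++ drop j p), last x (take i p ++ drop j p) = last x p,
    msub (take i p ++ drop j p) p & size (take i p ++ drop j p) + (j - i) = size p].
Proof.
move=> lij lj pp eij.
have li : i <= size p by move: lij lj; clear; lia.
have Ei : last x (take i p) = nth 0 (x :: p) i.
  rewrite (last_nth 0) size_takel //.
  by case: i {eij lij li} => [|i] //=; rewrite nth_take.
have Ed := drop_nth 0 lj.
have pd : path e (nth 0 p j) (drop j.+1 p).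
  by have /drop_sorted := path_sorted pp => /(_ j); rewrite Ed.
split.
- by rewrite Ed cat_path take_path //= Ei eij.
- by rewrite -{3}(cat_take_drop j p) !last_cat Ed.
- have Ep := cat_take_drop j p; have Et := cat_take_drop i (take j p).
  by rewrite take_takel // in Et; move=> z; rewrite -{3}Ep -Et; cnt z.
- by rewrite size_cat size_takel // size_drop; move: lij lj li; clear; lia.
Qed.

(** The starting term [a] is left out, so that the list can follow it in a [path]. *)
Fixpoint up (a c m : nat) : seq nat :=
  if m is m'.+1 then a + c :: up (a + c) c m' else [::].
Fixpoint dn (a c m : nat) : seq nat :=
  if m is m'.+1 then a - c :: dn (a - c) c m' else [::].

Lemma path_up (e : rel nat) a c m : (forall x, e x (x + c)) -> path e a (up a c m).
Proof. by move=> H; elim: m a => //= m IH a; rewrite H IH. Qed.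

Lemma path_dn (e : rel nat) a c m : (forall x, e (x + c) x) -> c * m <= a ->
  path e a (dn a c m).
Proof.
move=> H; elim: m a => //= m IH a; rewrite mulnS => le_a.
have -> : e a (a - c) by have := H (a - c); rewrite subnK // (leq_trans _ le_a) // leq_addr.
by apply: IH; rewrite leq_subRL // (leq_trans _ le_a) // leq_addr.
Qed.

Lemma last_up a c m : last a (up a c m) = a + c * m.
Proof. by elim: m a => [|m IH] a /=; rewrite ?muln0 ?addn0 // IH mulnS addnA. Qed.

Lemma last_dn a c m : last a (dn a c m) = a - c * m.
Proof. by elim: m a => [|m IH] a /=; rewrite ?muln0 ?subn0 // IH mulnS subnDA. Qed.

Lemma size_up a c m : size (up a c m) = m.
Proof. by elim: m a => //= m IH a; rewrite IH. Qed.

Lemma size_dn a c m : size (dn a c m) = m.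
Proof. by elim: m a => //= m IH a; rewrite IH. Qed.

Lemma mem_up a c m (x : nat) : x \in up a c m -> exists i, i < m /\ x = a + c + c * i.
Proof.
elim: m a => //= m IH a; rewrite inE => /orP[/eqP->|/IH[i [li ->]]].
  by exists 0; rewrite muln0 addn0.
by exists i.+1; rewrite mulnS addnA.
Qed.

Lemma mem_dn a c m (x : nat) : c * m <= a -> x \in dn a c m ->
  exists i, i < m /\ x + c + c * i = a.
Proof.
elim: m a => //= m IH a; rewrite mulnS inE => le_a.
have le_ca : c <= a by apply: leq_trans le_a; rewrite leq_addr.
case/orP=> [/eqP->|].
  by exists 0; rewrite muln0 addn0 subnK.
have le_m : c * m <= a - c by rewrite leq_subRL.
case/(IH _ le_m) => i [li Ei]; exists i.+1; split=> //.
by rewrite mulnS addnCA addnC Ei subnK.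
Qed.

Lemma uniq_up a c m : 0 < c -> uniq (up a c m).
Proof.
move=> c0; elim: m a => //= m IH a; rewrite IH andbT.
by apply/negP => /mem_up [i [_]]; move: c0; generalize (c * i); clear; lia.
Qed.

Lemma uniq_dn a c m : 0 < c -> c * m <= a -> uniq (dn a c m).
Proof.
move=> c0; elim: m a => //= m IH a; rewrite mulnS => le_a.
have le_ca : c <= a by apply: leq_trans le_a; rewrite leq_addr.
have le_m : c * m <= a - c by rewrite leq_subRL.
rewrite IH // andbT; apply/negP => /(mem_dn le_m) [i [_]].
by move: c0; generalize (c * i) (a - c); clear; lia.
Qed.

Lemma uniq_two (A B : seq nat) x y : uniq A -> uniq B -> x != y ->
    (forall z, z \in A -> [/\ z != x, z != y & z \notin B]) ->
    (forall z, z \in B -> z != x /\ z != y) -> uniq (x :: A ++ y :: B).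
Proof.
move=> uA uB xy HA HB; rewrite cons_uniq cat_uniq [uniq (y :: B)]cons_uniq.
rewrite mem_cat (in_cons y) uA uB (negPf xy) !andbT /= negb_or; apply/and3P; split.
- apply/andP; split; first by apply/negP => /HA[]; rewrite eqxx.
  by apply/negP => /HB[]; rewrite eqxx.
- rewrite negb_or; apply/andP; split.
    by apply/negP => /HA[_]; rewrite eqxx.
  by apply/hasPn => z zB; apply/negP => /HA[_ _]; rewrite zB.
- by apply/negP => /HB[_]; rewrite eqxx.
Qed.

(** * Closing the blue cycle *)

Section Flexibility.

Variables hf n : nat.
Local Notation k := (2 * hf + 3).
Local Notation forces := (forces k n).

Lemma brb_run d h y zs us ps X : brb hf h y zs us ps ->
    uniq (X ++ y :: zs ++ us ++ ps) ->
  forces (3 * d + ne ps) h (fun h' => exists y' zs' us' ps',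
    [/\ brb hf h' y' zs' us' ps', uniq (X ++ y' :: zs' ++ us' ++ ps') &
      size (zs' ++ us' ++ ps') = size (zs ++ us ++ ps) + d]).
Proof.
elim: d h y zs us ps => [|d IH] h y zs us ps st uX.
  apply: (@forces_weaken _ _ 0 _ _ (fun=> True)) => //; last exact: forces_ret.
  move=> h1 e1 _; exists y, zs, us, ps; rewrite addn0; split=> //.
  exact: brb_ext e1 st.
have [v uv] := fresh uX.
have u1 : Uq (v :: y :: zs ++ us ++ ps) by rewrite /Uq; uq.
have -> : 3 * d.+1 + ne ps = 3 * d + 3 + ne ps by rewrite mulnS; clear; lia.
apply: (brb_step st u1) => h1 y1 zs1 us1 ps1 e1 st1 p1.
have u2 : uniq (X ++ y1 :: zs1 ++ us1 ++ ps1) by uq.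
apply: forces_weaken (IH _ _ _ _ _ st1 u2) => // h2 e2.
move=> [y2 [zs2 [us2 [ps2 [H1 H2 H3]]]]]; exists y2, zs2, us2, ps2; split=> //.
have := perm_size p1; rewrite H3 /= !size_cat; clear; lia.
Qed.

Lemma forces_path_scan (D : rel nat) (f : nat -> nat) h i s :
    path (fun i j => D i j && (f i != f j)) i s ->
  forces (size s) h (fun h' => path (rd h') (f i) (map f s) \/
    exists a b, [/\ a \in i :: s, b \in i :: s, D a b & bl h' (f a) (f b)]).
Proof.
elim: s h i => [|j s IH] h i /=; first by move=> _; apply: forces_ret; left.
case/andP=> /andP[Dij nij] ps; apply: (forces_if nij) => h1 e1 c1; last first.
  apply: forces_ret => h2 e2; right; exists i, j.
  by rewrite !inE !eqxx orbT Dij (bl_ext e2 c1).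
apply: forces_weaken (IH h1 j ps) => // h2 e2; push_ext e2.
rewrite c1 => -[->|[a [b [H1 H2 H3 H4]]]]; first by left.
by right; exists a, b; rewrite !(in_cons i) H1 H2 !orbT.
Qed.

(** If the images of cyclically consecutive indices were all joined in red, they would form a red
    [C_k]. *)
Lemma forces_cycle_scan (D : rel nat) (f : nat -> nat) h C :
    size C = k -> cycle D C -> (forall i j, D i j -> i != j) ->
    {in C &, injective f} -> uniq C ->
  forces k h (fun h' =>
    exists a b, [/\ a \in C, b \in C, D a b & bl h' (f a) (f b)]).
Proof.
case: C => [|i s] sC cC nD injf uC; first by move: sC; rewrite addnC.
have pC : path (fun i j => D i j && (f i != f j)) i (rcons s i).
  move: cC => /=; apply: (sub_in_path (P := mem (i :: s))).
    move=> x y xC yC Dxy; rewrite Dxy /=; apply/eqP => /(injf _ _ xC yC) Exy.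
    by have := nD _ _ Dxy; rewrite Exy eqxx.
  apply/allP => x xs; have : x \in i :: s; last by [].
  by move: xs; rewrite !in_cons mem_rcons in_cons; case: (x == i).
have := forces_path_scan h pC; rewrite size_rcons -[(size s).+1]/(size (i :: s)) sC => F.
apply: (forces_seq (c2 := 0) F) => [|h1 e1]; first by rewrite addn0.
case=> [pr|[a [b [H1 H2 H3 H4]]]]; last first.
  apply: forces_ret => h2 e2; exists a, b; rewrite (bl_ext e2 H4); split=> //.
    by move: H1; rewrite !inE mem_rcons inE orbA orbb.
  by move: H2; rewrite !inE mem_rcons inE orbA orbb.
apply: (@forces_red_cycle _ _ _ _ _ (map f (i :: s))).
- by clear; lia.
- by rewrite size_map.
- by rewrite map_inj_in_uniq.
- by move: pr; rewrite map_rcons.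
Qed.

(** With truncated subtraction the sum is the distance of [i] and [j]. *)
Definition near (L : seq nat) : rel nat :=
  fun i j => ((i - j) + (j - i) \in L).

Lemma near_neq L i j : 0 \notin L -> near L i j -> i != j.
Proof. by move=> L0; apply: contraTneq => ->; rewrite /near subnn. Qed.

Lemma near_up L c x : c \in L -> near L x (x + c).
Proof. by rewrite /near addKn (_ : x - _ = 0) //; clear; lia. Qed.

Lemma near_dn L c x : c \in L -> near L (x + c) x.
Proof. by rewrite /near addKn (_ : x - _ = 0) ?addn0 //; clear; lia. Qed.

Lemma path_mem_chord h (x : nat) (p : seq nat) (a b d : nat) : uniq (x :: p) -> path (bl h) x p ->
    1 < d -> near [:: d] a b -> a < size (x :: p) -> b < size (x :: p) ->
    bl h (nth 0 (x :: p) a) (nth 0 (x :: p) b) ->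
  exists q, [/\ path (bl h) x q, last x q = last x p, msub q p &
    size q + d.-1 = size p].
Proof.
wlog le_ab : a b / a <= b.
  move=> IH ux px d1 nab la lb cab; have [le_ab|lt_ba] := leqP a b.
    exact: (IH a b).
  apply: (IH b a) => //; first exact: ltnW.
    by move: nab; rewrite /near addnC.
  by rewrite blC.
move=> ux px d1; rewrite /near inE => /eqP Ed la lb cab.
case: b Ed lb le_ab cab => [|b] Ed lb le_ab cab; first by move: Ed d1 le_ab; clear; lia.
have le1 : a <= b by move: Ed d1 le_ab; clear; lia.
have [|H1 H2 H3 H4] := path_skip le1 _ px cab; first by [].
exists (take a p ++ drop b p); split=> //.
by rewrite -H4; congr (_ + _); move: Ed d1 le_ab; clear; lia.
Qed.

(* Two index cycles of length [k]: the chords of the first one skip 1, 2 or 4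
   vertices of the path, those of the second one skip 1 or 3 vertices. Not all
   chords of such a cycle are red, whence two versions of the path whose
   lengths differ by 1. *)
Lemma forces_flex h (x : nat) (p : seq nat) : uniq (x :: p) -> path (bl h) x p ->
    4 * hf + 5 <= size p ->
  forces (2 * k) h (fun h' => exists M M',
    [/\ path (bl h') x M, path (bl h') x M', last x M = last x p &
        last x M' = last x p] /\
    [/\ msub M p, msub M' p, size M' = (size M).+1 & size p <= size M + 4]).
Proof.
move=> ux px sp.
(* [C1] is [0, 2, ..., 2 hf + 2, 2 hf + 5, 2 hf + 3, ..., 5] and [C2] is [0, 4, ..., 4 hf + 4, 4 hf
   + 2, 4 hf - 2, ..., 2]: steps of 3 and 5, respectively two steps of 2, join an ascending and a
   descending progression. All indices are at most [4 hf + 5]. *)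
pose C1 := 0 :: up 0 2 hf.+1 ++ 2 * hf + 5 :: dn (2 * hf + 5) 2 hf.
pose C2 := 0 :: up 0 4 hf.+1 ++ 4 * hf + 2 :: dn (4 * hf + 2) 4 hf.
have sC1 : size C1 = k by rewrite /C1 /= size_cat /= size_up size_dn; clear; lia.
have sC2 : size C2 = k by rewrite /C2 /= size_cat /= size_up size_dn; clear; lia.
have cC1 : cycle (near [:: 2; 3; 5]) C1.
  rewrite /C1 /= rcons_cat cat_path; apply/andP; split.
    by apply: path_up => y; apply: near_up.
  rewrite last_up /= rcons_path last_dn; apply/and3P; split.
  - by rewrite /near !inE; clear; lia.
  - by apply: path_dn => [y|]; [apply: near_dn | clear; lia].
  - by rewrite /near !inE; clear; lia.
have cC2 : cycle (near [:: 2; 4]) C2.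
  rewrite /C2 /= rcons_cat cat_path; apply/andP; split.
    by apply: path_up => y; apply: near_up.
  rewrite last_up /= rcons_path last_dn; apply/and3P; split.
  - by rewrite /near !inE; clear; lia.
  - by apply: path_dn => [y|]; [apply: near_dn | clear; lia].
  - by rewrite /near !inE; clear; lia.
have le1 : 2 * hf <= 2 * hf + 5 by clear; lia.
have le2 : 4 * hf <= 4 * hf + 2 by clear; lia.
have uC1 : uniq C1.
  apply: uniq_two; rewrite ?uniq_up ?uniq_dn //.
  - by clear; lia.
  - move=> z /mem_up[j [_ Ej]]; split; try by move: Ej; clear; lia.
    by apply/negP => /(mem_dn le1)[i]; move: Ej; clear; lia.
  - by move=> z /(mem_dn le1)[i]; clear; lia.
have uC2 : uniq C2.
  apply: uniq_two; rewrite ?uniq_up ?uniq_dn //.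
  - by clear; lia.
  - move=> z /mem_up[j [_ Ej]]; split; try by move: Ej; clear; lia.
    by apply/negP => /(mem_dn le2)[i]; move: Ej; clear; lia.
  - by move=> z /(mem_dn le2)[i]; clear; lia.
have lC1 (i : nat) : i \in C1 -> i < size (x :: p).
  rewrite in_cons mem_cat (in_cons (2 * hf + 5)) => /or4P[/eqP->|/mem_up[j [lj ->]]|/eqP->|];
    rewrite [size (x :: p)]/=; [| move: lj | |move/(mem_dn le1) => [j [lj]]; move: lj];
    move: sp; clear; lia.
have lC2 (i : nat) : i \in C2 -> i < size (x :: p).
  rewrite in_cons mem_cat (in_cons (4 * hf + 2)) => /or4P[/eqP->|/mem_up[j [lj ->]]|/eqP->|];
    rewrite [size (x :: p)]/=; [| move: lj | |move/(mem_dn le2) => [j [lj]]; move: lj];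
    move: sp; clear; lia.
have inj (C : seq nat) : (forall i, i \in C -> i < size (x :: p)) ->
    {in C &, injective (nth 0 (x :: p))}.
  by move=> lC i j /lC li /lC lj /eqP; rewrite nth_uniq // => /eqP.
have F1 := forces_cycle_scan h sC1 cC1 (fun i j => @near_neq [:: 2; 3; 5] i j isT) (inj _ lC1) uC1.
have E2 : k + k <= 2 * k by clear; lia.
apply: (forces_seq F1 E2) => h1 e1 [a [b [aC bC nab cab]]]; push_ext e1.
have F2 := forces_cycle_scan h1 sC2 cC2 (fun i j => @near_neq [:: 2; 4] i j isT) (inj _ lC2) uC2.
apply: forces_weaken F2 => // h2 e2 [a' [b' [aC' bC' nab' cab']]]; push_ext e2.
have ch1 d (nd : near [:: d] a b) (d1 : 1 < d) :=
  path_mem_chord ux px d1 nd (lC1 _ aC) (lC1 _ bC) cab.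
have ch2 d (nd : near [:: d] a' b') (d1 : 1 < d) :=
  path_mem_chord ux px d1 nd (lC2 _ aC') (lC2 _ bC') cab'.
have spl1 : [|| near [:: 2] a b, near [:: 3] a b | near [:: 5] a b].
  by move: nab; rewrite /near !inE.
have spl2 : near [:: 2] a' b' || near [:: 4] a' b'.
  by move: nab'; rewrite /near !inE.
have skip1 : (exists q, [/\ path (bl h2) x q, last x q = last x p, msub q p &
    size q + 1 = size p]) -> exists M M',
    [/\ path (bl h2) x M, path (bl h2) x M', last x M = last x p &
        last x M' = last x p] /\
    [/\ msub M p, msub M' p, size M' = (size M).+1 & size p <= size M + 4].
  move=> [q [H1 H2 H3 H4]]; exists q, p; split; split=> //.
    by rewrite -H4 addn1.
  by rewrite -H4; clear; lia.
(* A chord of length 2 is compared with the path itself; otherwise lengths 3 and 4, or 5 and 4, are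
   compared. *)
case/or3P: spl1 => n1; first by apply: skip1; apply: (ch1 2).
- case/orP: spl2 => n2; first by apply: skip1; apply: (ch2 2).
  have [M' [H1 H2 H3 H4]] := ch1 3 n1 isT.
  have [M [H1' H2' H3' H4']] := ch2 4 n2 isT.
  by exists M, M'; split; split=> //; move: H4 H4'; clear; lia.
- case/orP: spl2 => n2; first by apply: skip1; apply: (ch2 2).
  have [M [H1 H2 H3 H4]] := ch1 5 n1 isT.
  have [M' [H1' H2' H3' H4']] := ch2 4 n2 isT.
  by exists M, M'; split; split=> //; move: H4 H4'; clear; lia.
Qed.

End Flexibility.

(* [Ab i] says that [b] is joined in blue to the [i]-th vertex of the front
   path, and so on; the first four conditions avoid a blue [C_n], the other ones
   a red [C_k]. *)
Record closing (hf W : nat) (Ab Ac Bb Bc : nat -> bool) : Prop := Closing {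
  close_bb : forall i j, i < W -> j < W -> (i == j) || (i == j.+1) -> Ab i -> ~~ Bb j;
  close_cc : forall i j, i < W -> j < W -> (i == j) || (i == j.+1) -> Ac i -> ~~ Bc j;
  close_bc : forall i j, i < W -> j < W -> (i == j.+2) || (i == j.+3) -> Ab i -> ~~ Bc j;
  close_cb : forall i j, i < W -> j < W -> (i == j.+2) || (i == j.+3) -> Ac i -> ~~ Bb j;
  close_Abc : forall i, i + hf < W -> Ab i || Ac (i + hf);
  close_Acb : forall i, i + hf < W -> Ac i || Ab (i + hf);
  close_Bbc : forall i, i + hf < W -> Bb i || Bc (i + hf);
  close_Bcb : forall i, i + hf < W -> Bc i || Bb (i + hf) }.

Lemma closing_swap hf W Ab Ac Bb Bc :
  closing hf W Ab Ac Bb Bc -> closing hf W Ac Ab Bc Bb.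
Proof. by case. Qed.

(** [Bb j] excludes [Ab] at [j], [j + 1] and [Ac] at [j + 2], [j + 3]. Hence [Ac] holds at
    [j + hf + 1] and [Ab] at [j + hf + 2], which excludes [Bc] and [Bb] at [j + hf + 1]; this in
    turn gives [Bb] and [Bc] at [j + 1]. *)
Lemma closing_step hf W Ab Ac Bb Bc j : closing hf W Ab Ac Bb Bc ->
    j + hf + 3 < W -> Bb j ->
  [&& Bb j.+1, Bc j.+1, ~~ Bb (j + hf).+1 & ~~ Bc (j + hf).+1].
Proof.
move=> C ltW Bbj.
have lt i : i <= j + hf + 3 -> i < W by move: ltW; clear; lia.
have A1 i : (i == j) || (i == j.+1) -> Ac (i + hf).
  move=> Ei; have li : i < W by apply: lt; move: Ei; clear; lia.
  have := close_Abc C (_ : i + hf < W); rewrite lt; last by move: Ei; clear; lia.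
  move=> /(_ isT)/orP[Abi|//].
  have lj : j < W by apply: lt; clear; lia.
  by have := close_bb C li lj Ei Abi; rewrite Bbj.
have A2 i : (i == j.+2) || (i == j.+3) -> Ab (i + hf).
  move=> Ei; have li : i < W by apply: lt; move: Ei; clear; lia.
  have := close_Acb C (_ : i + hf < W); rewrite lt; last by move: Ei; clear; lia.
  move=> /(_ isT)/orP[Aci|//].
  have lj : j < W by apply: lt; clear; lia.
  by have := close_cb C li lj Ei Aci; rewrite Bbj.
have lj1 : (j + hf).+1 < W by apply: lt; clear; lia.
have nc : ~~ Bc (j + hf).+1.
  have := close_cc C lj1 lj1; rewrite eqxx; apply=> //.
  by have := A1 j.+1; rewrite addSn eqxx orbT; apply.
have nb : ~~ Bb (j + hf).+1.
  have lj2 : (j + hf).+2 < W by apply: lt; clear; lia.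
  have := close_bb C lj2 lj1; rewrite eqxx orbT; apply=> //.
  by have := A2 j.+2; rewrite !addSn eqxx; apply.
rewrite nb nc !andbT; apply/andP; split.
  by have := close_Bbc C (_ : j.+1 + hf < W); rewrite addSn (negPf nc) orbF; apply.
by have := close_Bcb C (_ : j.+1 + hf < W); rewrite addSn (negPf nb) orbF; apply.
Qed.

(** One of [Bb], [Bc] holds at some [j0 <= hf]. By iterated steps [Bb] spreads to [j0 + hf + 1],
    where the first step excludes it. The steps are taken at indices up to [2 * hf], whence the
    width [3 * hf + 4]. *)
Lemma closing_absurd hf Ab Ac Bb Bc : ~ closing hf (3 * hf + 4) Ab Ac Bb Bc.
Proof.
move=> C; set W := _ + 4 in C.
have step j : j + hf + 3 < W -> Bb j || Bc j ->
    [&& Bb j.+1, Bc j.+1, ~~ Bb (j + hf).+1 & ~~ Bc (j + hf).+1].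
  move=> lj /orP[|H]; first exact: (closing_step C lj).
  by have /and4P[-> -> -> ->] := closing_step (closing_swap C) lj H.
have [j0 lj0 H0] : exists2 j0, j0 <= hf & Bb j0 || Bc j0.
  have W0 : 0 + hf < W by rewrite /W; clear; lia.
  have /orP[H|H] := close_Bbc C W0; first by exists 0; rewrite ?H.
  by exists hf; rewrite // -[X in Bc X]add0n H orbT.
have lW : j0 + hf + 3 < W by rewrite /W; move: lj0; clear; lia.
have up m : m <= hf -> Bb (j0 + m).+1.
  elim: m => [|m IH] lm; rewrite ?addn0 ?addnS.
    by have /and4P[] := step j0 lW H0.
  have lW' : (j0 + m).+1 + hf + 3 < W by rewrite /W; move: lm lj0; clear; lia.
  by have := step _ lW'; rewrite IH 1?ltnW // => /(_ isT)/and4P[].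
have := up hf (leqnn _).
by have /and4P[_ _ /negPf->] := step j0 lW H0.
Qed.

(* Lacks the first vertex [f i] of the zigzag, so as to be the tail of a [path]. *)
Fixpoint zg (f g : nat -> nat) i m : seq nat :=
  if m is m'.+1 then g i.+1 :: f i.+1 :: zg f g i.+1 m' else [::].

Lemma size_zg f g i m : size (zg f g i m) = 2 * m.
Proof. by elim: m i => // m IH i; rewrite /= IH; clear; lia. Qed.

Lemma last_zg f g i m : last (f i) (zg f g i m) = f (i + m).
Proof. by elim: m i => [|m IH] i /=; rewrite ?addn0 // IH addSnnS. Qed.

Lemma path_zg (e : rel nat) f g i m :
    (forall j, i <= j -> j < i + m -> e (f j) (g j.+1) && e (g j.+1) (f j.+1)) ->
  path e (f i) (zg f g i m).
Proof.
elim: m i => //= m IH i H; have /andP[-> ->] : e (f i) (g i.+1) && e (g i.+1) (f i.+1).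
  by apply: H; clear; lia.
by apply: IH => j l1 l2; apply: H; move: l1 l2; clear; lia.
Qed.

Lemma zg_msub f g i m :
  msub (f i :: zg f g i m) (map f (iota i m.+1) ++ map g (iota i.+1 m)).
Proof.
elim: m i => [|m IH] i z; first by [].
by have := IH i.+1 z; cnt_norm; cnt_atoms z; clear; lia.
Qed.

Lemma map_nth_sub (L : seq nat) i m : i + m <= size L ->
  msub (map (nth 0 L) (iota i m)) L.
Proof.
move=> le_m; rewrite map_nth_iota; last by move: le_m; clear; lia.
by have E1 := cat_take_drop i L; have E2 := cat_take_drop m (drop i L); uq.
Qed.

Lemma nth_split (L : seq nat) i : i < size L ->
  L = take i L ++ nth 0 L i :: drop i.+1 L.
Proof. by move=> li; rewrite -drop_nth // cat_take_drop. Qed.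

(** * Blue cycles and red zigzags across a path *)

Section Closing.

Variables (hf n : nat).
Local Notation k := (2 * hf + 3).
Local Notation forces := (forces k n).
Hypothesis n0 : 0 < n.

(** The zigzag from [f i] to [f (i + hf)] has [2 * hf + 1] vertices; [u] and [w] complete it to a
    red [C_k]. *)
Lemma forces_red_zg c h Psi f g i u w (A B : seq nat) : uniq (u :: w :: A ++ B) ->
    msub (map f (iota i hf.+1)) A -> msub (map g (iota i.+1 hf)) B ->
    (forall j, i <= j -> j < i + hf -> rd h (f j) (g j.+1) && rd h (g j.+1) (f j.+1)) ->
    rd h u w -> rd h u (f i) -> rd h w (f (i + hf)) ->
  forces c h Psi.
Proof.
move=> us mA mB H ruw rui rwi.
apply: (@forces_red_cycle _ _ _ _ _ (w :: u :: f i :: zg f g i hf)).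
- by clear; lia.
- by rewrite /= size_zg; clear; lia.
- by have zs := zg_msub f g i hf; uq.
rewrite /= rdC ruw rui /= rcons_path path_zg //= last_zg.
by rewrite rdC.
Qed.

Definition zigzag_red (A B : seq nat) W h : Prop :=
  (forall i, i < W -> rd h (nth 0 A i) (nth 0 B i)) /\
  (forall i, i.+1 < W -> rd h (nth 0 A i) (nth 0 B i.+1)).

Lemma zigzag_red_ext A B W h h' : extends h h' ->
  zigzag_red A B W h -> zigzag_red A B W h'.
Proof. by move=> e [H1 H2]; split=> i li; apply: rd_ext e _; [apply: H1|apply: H2]. Qed.

Lemma forces_red_zigA c h Psi (A B : seq nat) W i u w : uniq (u :: w :: A ++ B) ->
    zigzag_red A B W h -> W <= size A -> W <= size B -> i + hf < W ->
    rd h u w -> rd h u (nth 0 A i) -> rd h w (nth 0 A (i + hf)) ->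
  forces c h Psi.
Proof.
move=> us [H1 H2] lA lB li; apply: (@forces_red_zg _ _ _ (nth 0 A) (nth 0 B) _ _ _ A B) => //.
- by apply: map_nth_sub; move: lA li; clear; lia.
- by apply: map_nth_sub; move: lB li; clear; lia.
move=> j l1 l2; rewrite H2 1?rdC ?H1 //; move: l1 l2 li; clear; lia.
Qed.

Lemma forces_red_zigB c h Psi (A B : seq nat) W i u w : uniq (u :: w :: A ++ B) ->
    zigzag_red A B W h -> W <= size A -> W <= size B -> i + hf < W ->
    rd h u w -> rd h u (nth 0 B i) -> rd h w (nth 0 B (i + hf)) ->
  forces c h Psi.
Proof.
move=> us [H1 H2] lA lB li.
(* From [B_j] the zigzag reaches [B_(j+1)] through [A_j], whence the shift by one. *)
apply: (@forces_red_zg _ _ _ (nth 0 B) (fun x => nth 0 A x.-1) _ _ _ B A) => //.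
- by uq.
- by apply: map_nth_sub; move: lB li; clear; lia.
- rewrite -add1n iotaDl -map_comp (eq_map (g := nth 0 A)) //.
  by apply: map_nth_sub; move: lA li; clear; lia.
move=> j l1 l2 /=; rewrite rdC H1 ?H2 //; move: l1 l2 li; clear; lia.
Qed.

Lemma forces_zigzag_scan h (A B : seq nat) W : uniq (A ++ B) ->
    W <= size A -> W <= size B ->
  forces (2 * W) h (fun h' => zigzag_red A B W h' \/
    exists i j, [/\ i < W, j < W, (j == i) || (j == i.+1) &
      bl h' (nth 0 A i) (nth 0 B j)]).
Proof.
move=> uAB lA lB.
pose L := [seq (nth 0 A i, nth 0 B i) | i <- iota 0 W] ++
          [seq (nth 0 A i, nth 0 B i.+1) | i <- iota 0 W.-1].
have nAB i j : i < W -> j < W -> nth 0 A i != nth 0 B j.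
  move=> li lj; apply/eqP => Eij; move: uAB; rewrite cat_uniq => /and3P[_ /hasPn nAB _].
  have /nAB : nth 0 B j \in B by rewrite mem_nth // (leq_trans lj).
  by rewrite -Eij /= mem_nth // (leq_trans li).
have inL e : e \in L -> exists i j, [/\ i < W, j < W, (j == i) || (j == i.+1) &
    e = (nth 0 A i, nth 0 B j)].
  rewrite mem_cat => /orP[] /mapP[i]; rewrite mem_iota => li ->.
    by exists i, i; split; rewrite ?eqxx //; move: li; clear; lia.
  by exists i, i.+1; split; rewrite ?eqxx ?orbT //; move: li; clear; lia.
have aL : all (fun e => e.1 != e.2) L.
  by apply/allP => e /inL[i [j [li lj _ ->]]]; apply: nAB.
apply: forces_weaken (forces_scan k n h aL).
  by rewrite size_cat !size_map !size_iota; clear; lia.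
move=> h1 e1 [/allP H|[L1 [e [L2 [EL _ H]]]]].
  left; split=> i li.
    apply: (H (nth 0 A i, nth 0 B i)); rewrite mem_cat; apply/orP; left.
    by apply/mapP; exists i => //; rewrite mem_iota.
  apply: (H (nth 0 A i, nth 0 B i.+1)); rewrite mem_cat; apply/orP; right.
  by apply/mapP; exists i => //; rewrite mem_iota; move: li; clear; lia.
right; have /inL[i [j [li lj Eij Ee]]] : e \in L by rewrite EL mem_cat in_cons eqxx orbT.
by exists i, j; split=> //; move: H; rewrite Ee.
Qed.

Lemma forces_blue_mid c h Psi (X Y Z t : seq nat) x y :
    sorted (bl h) (X ++ x :: Y ++ y :: Z) -> path (bl h) y (rcons t x) ->
    uniq (t ++ X ++ x :: Y ++ y :: Z) -> size (x :: Y ++ y :: t) = n ->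
  forces c h Psi.
Proof.
move=> /cat_sorted2[_ /= pY] pt us sn.
apply: (@forces_blue_cycle _ _ _ _ _ (x :: Y ++ y :: t)) => //; first by uq.
rewrite /= rcons_cat /= cat_path /= pt andbT.
by move: pY; rewrite cat_path /= => /and3P[-> ->].
Qed.

(** The cycle uses [A] from index [i] on, [m], the first [j + 1] vertices of [B], and returns
    through [t]. *)
Lemma forces_close c h Psi (A m B t : seq nat) i j : i < size A -> j < size B ->
    sorted (bl h) (A ++ m ++ B) -> path (bl h) (nth 0 B j) (rcons t (nth 0 A i)) ->
    uniq (t ++ A ++ m ++ B) -> size A + size m + size t + j + 1 = n + i ->
  forces c h Psi.
Proof.
move=> li lj sAB pt us sn; have EA := nth_split li; have EB := nth_split lj.
have E : A ++ m ++ B = take i A ++ nth 0 A i :: (drop i.+1 A ++ m ++ take j B) ++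
    nth 0 B j :: drop j.+1 B by rewrite {1}EA {1}EB -!catA /= -?catA.
rewrite E in sAB us; apply: forces_blue_mid sAB pt us _.
rewrite /= !(size_cat, size_drop) /= size_takel 1?ltnW //.
by move: sn li; clear; lia.
Qed.

(** Lengths are such that with [m0] a blue [C_n] closes by a direct edge if [j = i + 1], through [b]
    or [c] alone if [i = j], and through all of [b a c] if [i = j + 2]; with [m1], one vertex
    longer, if [j = i], [i = j + 1] and [i = j + 3]. These are the offsets in [closing]. *)
Lemma forces_xc h Psi (A m0 m1 B : seq nat) (a b c : nat) : tri h a b c ->
    uniq (a :: b :: c :: A ++ m0 ++ B) -> uniq (a :: b :: c :: A ++ m1 ++ B) ->
    sorted (bl h) (A ++ m0 ++ B) -> sorted (bl h) (A ++ m1 ++ B) ->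
    size m1 = (size m0).+1 -> size A + size m0 + 2 = n ->
    3 * hf + 4 <= size A -> 3 * hf + 4 <= size B ->
  forces (6 * (3 * hf + 4)) h Psi.
Proof.
set W := 3 * hf + 4 => tr u0 u1 s0 s1 sm sn lA lB.
have uAB : uniq (A ++ B) by uq.
have F1 := forces_zigzag_scan h uAB lA lB.
apply: (forces_seq (c2 := 4 * W) F1) => [|h1 e1]; first by clear; lia.
push_ext e1; have {}tr := tri_ext e1 tr.
have u0b : uniq ([::] ++ A ++ m0 ++ B) by uq.
have u1b : uniq ([::] ++ A ++ m1 ++ B) by uq.
case=> [zz|[i [j [li lj Eij cij]]]]; last first.
  have {}li := leq_trans li lA; have {}lj := leq_trans lj lB.
  case/orP: Eij => /eqP Ej.
    apply: (forces_close _ _ (t := [::]) li lj s1) => //; first by rewrite /= blC cij.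
    by rewrite sm Ej /=; move: sn; clear; lia.
  apply: (forces_close _ _ (t := [::]) li lj s0) => //; first by rewrite /= blC cij.
  by rewrite Ej /=; move: sn; clear; lia.
pose L := [seq (b, nth 0 A i) | i <- iota 0 W] ++ [seq (c, nth 0 A i) | i <- iota 0 W]
  ++ [seq (b, nth 0 B i) | i <- iota 0 W] ++ [seq (c, nth 0 B i) | i <- iota 0 W].
have nin (u : nat) (M : seq nat) i : W <= size M -> i < W -> uniq (u :: M) -> u != nth 0 M i.
  move=> lM li /=/andP[nu _]; apply: contraNneq nu => ->.
  by rewrite mem_nth // (leq_trans li).
have aL : all (fun e => e.1 != e.2) L.
  rewrite /L !all_cat; apply/and4P; split; rewrite all_map; apply/allP => i;
    rewrite mem_iota add0n => li; apply: nin => //; uq.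
apply: (forces_seq (c2 := 0) (forces_reveal k n h1 aL)) => [|h2 e2].
  by rewrite !size_cat !size_map size_iota; clear; lia.
push_ext e2; have {}tr := tri_ext e2 tr; have {}zz := zigzag_red_ext e2 zz => rev.
have /and3P[ab ac bc] := tr.
have rv (i : nat) : i < W -> [/\ rd h2 b (nth 0 A i) \/ bl h2 b (nth 0 A i),
    rd h2 c (nth 0 A i) \/ bl h2 c (nth 0 A i),
    rd h2 b (nth 0 B i) \/ bl h2 b (nth 0 B i) &
    rd h2 c (nth 0 B i) \/ bl h2 c (nth 0 B i)].
  move=> li; have iI : i \in iota 0 W by rewrite mem_iota.
  split; [apply: (rev (b, nth 0 A i)) | apply: (rev (c, nth 0 A i)) |
    apply: (rev (b, nth 0 B i)) | apply: (rev (c, nth 0 B i))];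
    rewrite !mem_cat (map_f (fun i => (_, nth 0 _ i))) ?orbT //.
(* If Builder could not win, the revealed blue edges at [b] and [c] would satisfy [closing]. *)
apply: contrapT => nG.
have ub : uniq (b :: c :: A ++ B) by uq.
have uc : uniq (c :: b :: A ++ B) by uq.
have cb : rd h2 c b by rewrite rdC.
have one (u : nat) i j : i < W -> j < W -> (i == j) || (i == j.+1) ->
    msub [:: u] [:: a; b; c] -> bl h2 u (nth 0 A i) -> ~~ bl h2 u (nth 0 B j).
  move=> li lj Eij mu cA; apply/negP => cB; apply: nG.
  have {}li := leq_trans li lA; have {}lj := leq_trans lj lB.
  case/orP: Eij => /eqP Ei.
    apply: (forces_close _ _ (t := [:: u]) li lj s0); first by rewrite /= blC cB cA.
      by uq.
    by rewrite Ei; move: sn; clear; rewrite /=; lia.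
  apply: (forces_close _ _ (t := [:: u]) li lj s1); first by rewrite /= blC cB cA.
    by uq.
  by rewrite sm Ei; move: sn; clear; rewrite /=; lia.
have two (u w : nat) i j : i < W -> j < W -> (i == j.+2) || (i == j.+3) ->
    msub [:: u; w] [:: b; c] -> bl h2 a u -> bl h2 a w ->
    bl h2 u (nth 0 A i) -> ~~ bl h2 w (nth 0 B j).
  move=> li lj Eij mu au aw cA; apply/negP => cB; apply: nG.
  have {}li := leq_trans li lA; have {}lj := leq_trans lj lB.
  case/orP: Eij => /eqP Ei.
    apply: (forces_close _ _ (t := [:: w; a; u]) li lj s0).
    - by rewrite /= blC cB blC aw au cA.
    - by uq.
    by rewrite Ei; move: sn; clear; rewrite /=; lia.
  apply: (forces_close _ _ (t := [:: w; a; u]) li lj s1).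
  - by rewrite /= blC cB blC aw au cA.
  - by uq.
  by rewrite sm Ei; move: sn; clear; rewrite /=; lia.
apply: (@closing_absurd hf (fun i => bl h2 b (nth 0 A i)) (fun i => bl h2 c (nth 0 A i))
  (fun i => bl h2 b (nth 0 B i)) (fun i => bl h2 c (nth 0 B i))).
split=> i.
- by move=> j li lj Eij; apply: one => //; uq.
- by move=> j li lj Eij; apply: one => //; uq.
- by move=> j li lj Eij; apply: two => //; uq.
- by move=> j li lj Eij; apply: two => //; uq.
- move=> li; have [rb _ _ _] := rv _ (leq_ltn_trans (leq_addr hf i) li).
  have [_ rc _ _] := rv _ li.
  case: rb => [rb|->//]; case: rc => [rc|->]; last by rewrite orbT.
  by case: nG; apply: forces_red_zigA _ _ ub zz lA lB li bc rb rc.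
- move=> li; have [_ rc _ _] := rv _ (leq_ltn_trans (leq_addr hf i) li).
  have [rb _ _ _] := rv _ li.
  case: rc => [rc|->//]; case: rb => [rb|->]; last by rewrite orbT.
  by case: nG; apply: forces_red_zigA _ _ uc zz lA lB li cb rc rb.
- move=> li; have [_ _ rb _] := rv _ (leq_ltn_trans (leq_addr hf i) li).
  have [_ _ _ rc] := rv _ li.
  case: rb => [rb|->//]; case: rc => [rc|->]; last by rewrite orbT.
  by case: nG; apply: forces_red_zigB _ _ ub zz lA lB li bc rb rc.
- move=> li; have [_ _ _ rc] := rv _ (leq_ltn_trans (leq_addr hf i) li).
  have [_ _ rb _] := rv _ li.
  case: rc => [rc|->//]; case: rb => [rb|->]; last by rewrite orbT.
  by case: nG; apply: forces_red_zigB _ _ uc zz lA lB li cb rc rb.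
Qed.

End Closing.

(** * Triangles close or join long blue paths *)

Section Long.

Variables (hf n : nat).
Local Notation k := (2 * hf + 3).
Local Notation forces := (forces k n).
Hypothesis nk : 8 * k <= n.

Lemma n_gt0 : 0 < n.
Proof. by move: nk; clear; lia. Qed.

Lemma forces_xc_path c h Psi (R T : seq nat) : 22 * hf + 30 <= c -> tril h T ->
    uniq (T ++ R) -> sorted (bl h) R -> n + 3 * hf + 6 <= size R ->
  forces c h Psi.
Proof.
case: T => [|a [|b [|d []]]] // le_c; rewrite /tril => tr us sR lR.
(* The longest front that can be needed: the shortened middle [x :: M] has at least [4 * hf + 2]
   vertices, and front and middle together must have [n - 2]. *)
set r := n - 4 * hf - 4.
have lr : r < size R by move: nk lR; rewrite /r; clear; lia.
have ER := nth_split lr; set A0 := take _ _ in ER; set x := nth _ _ _ in ER.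
set p' := drop _ _ in ER.
have sA0 : size A0 = r by rewrite size_takel // ltnW.
have sp' : size p' + r.+1 = size R by rewrite size_drop subnK.
have Ep := cat_take_drop (4 * hf + 5) p'.
set p := take _ _ in Ep; set B := drop _ _ in Ep.
have sp : size p = 4 * hf + 5.
  by rewrite size_takel //; move: sp' lR nk; rewrite /r; clear; lia.
have sB : 3 * hf + 4 <= size B.
  by rewrite size_drop; move: sp' lR nk; rewrite /r; clear; lia.
have sb : sorted (bl h) (A0 ++ x :: p ++ B) by rewrite Ep -ER.
move: sb; rewrite sorted_cat_cons cat_path => /and3P[sA pp pB].
have uxp : uniq (x :: p) by uq.
have sp5 : 4 * hf + 5 <= size p by rewrite sp.
have F := forces_flex n uxp pp sp5.
apply: (forces_seq (c2 := 6 * (3 * hf + 4)) F) => [|h1 e1]; first by move: le_c; clear; lia.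
push_ext e1; have {}tr := tri_ext e1 tr.
case=> M [M' [[pM pM' lM lM'] [mM mM' sM' sM]]].
have lMp : size M' <= size p.
  have uM' : uniq M' by uq.
  apply: uniq_leq_size uM' _ => z zM; have := mM' z.
  by rewrite -has_pred1 has_count; move: zM; rewrite -has_pred1 has_count; clear; lia.
have sMs : size M <= 4 * hf + 4 by move: lMp; rewrite sM' sp; clear; lia.
have sMs' : 4 * hf + 1 <= size M by move: sM; rewrite sp; clear; lia.
(* The front is trimmed at its outer end once [M] is known. *)
have ED := cat_take_drop (r - (n - 3 - size M)) A0.
set A := drop _ _ in ED.
have lA : size A = n - 3 - size M.
  by rewrite size_drop sA0 /r; move: sMs sMs' nk; clear; lia.
have sAx : sorted (bl h1) (rcons A x).
  by move: sA; rewrite -ED rcons_cat => /cat_sorted2[].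
apply: (@forces_xc hf n n_gt0 _ _ A (x :: M) (x :: M') B a b d tr).
- by uq.
- by uq.
- by rewrite cat_cons sorted_cat_cons sAx cat_path pM lM.
- by rewrite cat_cons sorted_cat_cons sAx cat_path pM' lM'.
- by rewrite /= sM'.
- by rewrite lA /=; move: sMs nk; clear; lia.
- by rewrite lA; move: sMs nk; clear; lia.
by [].
Qed.

(** A blue zigzag edge links the paths directly. Otherwise the red zigzag and the red edge [b d]
    force a blue edge from [b] or [d] to each path, else a red [C_k] appears; the link is then this
    vertex, or [b a d] if the two edges use different vertices. *)
Lemma forces_join h (P Q T : seq nat) : tril h T -> uniq (T ++ P ++ Q) ->
    sorted (bl h) P -> sorted (bl h) Q -> hf < size P -> hf < size Q ->
  forces (2 * hf + 6) h (fun h' => exists R, [/\ sorted (bl h') R,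
    msub R (T ++ P ++ Q) & size P + size Q <= size R + 2 * hf]).
Proof.
case: T => [|a [|b [|d []]]] //; rewrite /tril => tr us sP sQ lP lQ.
have uPQ : uniq (P ++ Q) by uq.
have link h' i j t : sorted (bl h') P -> sorted (bl h') Q -> i <= hf -> j <= hf ->
    path (bl h') (nth 0 P i) (rcons t (nth 0 Q j)) -> msub t [:: a; b; d] ->
    exists R, [/\ sorted (bl h') R, msub R [:: a, b, d & P ++ Q] &
      size P + size Q <= size R + 2 * hf].
  move=> {}sP {}sQ li lj pt mt.
  have EP := nth_split (leq_ltn_trans li lP); have EQ := nth_split (leq_ltn_trans lj lQ).
  exists (rev (drop i.+1 P) ++ nth 0 P i :: t ++ nth 0 Q j :: drop j.+1 Q); split.
  - rewrite sorted_cat_cons; apply/andP; split.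
      rewrite -rev_cons sorted_adj_rev.
      by move: sP; rewrite {1}EP => /cat_sorted2[].
    move: pt; rewrite rcons_path cat_path /= => /andP[-> ->] /=.
    by move: sQ; rewrite {1}EQ => /cat_sorted2[].
  - by uq.
  rewrite !size_cat /= !size_cat size_rev /= !size_drop.
  by move: li lj lP lQ; clear; lia.
apply: (forces_seq (c2 := 4) (@forces_zigzag_scan hf n h P Q hf.+1 uPQ lP lQ)) => [|h1 e1].
  by clear; lia.
push_ext e1; have {}tr := tri_ext e1 tr.
case=> [zz|[i [j [li lj _ cij]]]]; last first.
  apply: forces_ret => h2 e2; push_ext e2; apply: (link h2 i j [::]) => //.
  by rewrite /= cij.
have P0 : 0 < size P by move: lP; clear; lia.
have Q0 : 0 < size Q by move: lQ; clear; lia.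
pose L := [:: (b, nth 0 P 0); (d, nth 0 P hf); (b, nth 0 Q 0); (d, nth 0 Q hf)].
have EP0 := nth_split P0; have EQ0 := nth_split Q0.
have EPh := nth_split lP; have EQh := nth_split lQ.
have aL : all (fun e => e.1 != e.2) L.
  have n1 : b != nth 0 P 0 by nq.
  have n2 : d != nth 0 P hf by nq.
  have n3 : b != nth 0 Q 0 by nq.
  have n4 : d != nth 0 Q hf by nq.
  by rewrite /= n1 n2 n3 n4.
apply: (forces_seq (c2 := 0) (forces_reveal k n h1 aL)) => // h2 e2.
push_ext e2; have {}tr := tri_ext e2 tr; have {}zz := zigzag_red_ext e2 zz => rev.
have /and3P[ab ad bd] := tr.
have ub : uniq (b :: d :: P ++ Q) by uq.
have lh : 0 + hf < hf.+1 by [].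
have bP : (exists u i, [/\ msub [:: u] [:: b; d], i <= hf & bl h2 u (nth 0 P i)]) \/
    forces 0 h2 (fun h' => exists R, [/\ sorted (bl h') R,
    msub R [:: a, b, d & P ++ Q] & size P + size Q <= size R + 2 * hf]).
  have [|r1|H] := rev (b, nth 0 P 0); first by rewrite !inE eqxx.
    have [|r2|H] := rev (d, nth 0 P hf); first by rewrite !inE eqxx !orbT.
      by right; apply: forces_red_zigA _ _ _ ub zz lP lQ lh bd r1 r2.
    by left; exists d, hf; split=> //; uq.
  by left; exists b, 0; split=> //; uq.
have bQ : (exists u i, [/\ msub [:: u] [:: b; d], i <= hf & bl h2 u (nth 0 Q i)]) \/
    forces 0 h2 (fun h' => exists R, [/\ sorted (bl h') R,
    msub R [:: a, b, d & P ++ Q] & size P + size Q <= size R + 2 * hf]).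
  have [|r1|H] := rev (b, nth 0 Q 0); first by rewrite !inE eqxx !orbT.
    have [|r2|H] := rev (d, nth 0 Q hf); first by rewrite !inE eqxx !orbT.
      by right; apply: forces_red_zigB _ _ _ ub zz lP lQ lh bd r1 r2.
    by left; exists d, hf; split=> //; uq.
  by left; exists b, 0; split=> //; uq.
case: bP => [[u [i [mu li cu]]]|//]; case: bQ => [[w [j [mw lj cw]]]|//].
apply: forces_ret => h3 e3; push_ext e3.
have {mu} mu : u = b \/ u = d.
  have := mu u; rewrite /= eqxx.
  by case: (b =P u) => [->|_]; [left|case: (d =P u) => [->|]; [right|]].
have {mw} mw : w = b \/ w = d.
  have := mw w; rewrite /= eqxx.
  by case: (b =P w) => [->|_]; [left|case: (d =P w) => [->|]; [right|]].
have [Ewu|nwu] := eqVneq u w.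
  apply: (link h3 i j [:: u]) => //; first by rewrite /= blC cu Ewu cw.
  by case: mu => ->; uq.
have au : bl h3 u a by case: mu => ->; rewrite blC.
have aw : bl h3 a w by case: mw => ->.
apply: (link h3 i j [:: u; a; w]) => //; first by rewrite /= blC cu au aw cw.
by move: nwu; case: mu => ->; case: mw => ->; rewrite ?eqxx // => _; uq.
Qed.

(** The red vertices [zs] are given up. If both blue paths have more than [hf] vertices, [T1] joins
    them and [T2] closes the result; otherwise the short one is dropped and [T1] closes the
    other. *)
Lemma forces_final c h Psi y (zs us ps T1 T2 : seq nat) : 24 * hf + 36 <= c ->
    tril h T1 -> tril h T2 -> brb hf h y zs us ps ->
    uniq (T1 ++ T2 ++ y :: zs ++ us ++ ps) ->
    n + 7 * hf + 6 <= size (zs ++ us ++ ps) ->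
  forces c h Psi.
Proof.
move=> le_c t1 t2 st us_ sz; have [_ pu pp sz2 _] := st.
have pps := path_sorted pp.
have {}sz : n + 5 * hf + 6 <= size (y :: us) + size ps.
  by move: sz sz2; rewrite !size_cat /=; clear; lia.
have [le_u|lt_u] := leqP (size (y :: us)) hf.
  apply: (@forces_xc_path _ _ _ (ps) T1) => //.
  - by move: le_c; clear; lia.
  - by uq.
  - by move: sz le_u; clear; lia.
have [le_p|lt_p] := leqP (size ps) hf.
  apply: (@forces_xc_path _ _ _ (y :: us) T1) => //.
  - by move: le_c; clear; lia.
  - by uq.
  - by move: sz le_p; clear; lia.
have uj : uniq (T1 ++ (y :: us) ++ ps) by uq.
have F := forces_join t1 uj pu pps lt_u lt_p.
apply: (forces_seq (c2 := 22 * hf + 30) F) => [|h1 e1 [R [sR mR lR]]].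
  by move: le_c; clear; lia.
apply: (@forces_xc_path _ _ _ (R) T2) => //.
- exact: tril_ext e1 t2.
- by uq.
by move: lR sz; clear; lia.
Qed.

End Long.

(** * Counting rounds *)

Section Two.

Variables (hf n : nat).
Local Notation k := (2 * hf + 3).
Local Notation forces := (forces k n).
Hypothesis nk : 8 * k <= n.

Lemma forces_ifp c h (u v : nat) Psi : 0 < c -> u != v ->
  (forall h', extends h h' -> rd h' u v -> forces c.-1 h' Psi) ->
  (forall h', extends h h' -> bl h' u v -> forces c.-1 h' Psi) -> forces c h Psi.
Proof. by case: c => // c _; apply: forces_if. Qed.

(* [forces_zero_*], [forces_one_*] and [forces_two_*] are about positions with
   that many disjoint triangles; the inequality on the budget [c] tells how many
   rounds a vertex of each stored path is worth. *)
Lemma forces_two_single c h Psi (R T1 T2 : seq nat) : 24 * hf + 37 <= c ->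
    3 * n + 45 * hf + 58 <= c + 3 * size R -> tril h T1 -> tril h T2 ->
    uniq (T1 ++ T2 ++ R) -> sorted (bl h) R ->
  forces c h Psi.
Proof.
wlog R0 : R / 0 < size R.
  case: R => [|x R] H le1 le2 t1 t2 us sR; last exact: (H (x :: R)).
  have uT : uniq (T1 ++ T2) by uq.
  have [v uv] := fresh uT.
  apply: (H [:: v]) => //; last by uq.
  by move: le2; rewrite /=; clear; lia.
case: R R0 => // y us _ le1 le2 t1 t2 us_ pu.
have st : brb hf h y [::] us [::] by [].
pose d := n + 7 * hf + 6 - size us.
have us' : uniq ((T1 ++ T2) ++ y :: [::] ++ us ++ [::]) by uq.
apply: (forces_seq (c2 := 24 * hf + 36) (brb_run n d st us')) => [|h1 e1].
  by move: le1 le2; rewrite /d /=; clear; lia.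
case=> y' [zs [us1 [ps [st' us1' sz]]]].
apply: (@forces_final hf n nk _ h1 _ y' zs us1 ps T1 T2); rewrite // ?(tril_ext e1) //.
  by uq.
by rewrite sz /= cats0 /d; clear; lia.
Qed.

(** The edge between the first vertices either becomes the red path of a [brb] state or joins the
    two blue paths. *)
Lemma forces_two c h Psi (A B T1 T2 : seq nat) : 24 * hf + 38 <= c ->
    3 * n + 45 * hf + 59 <= c + 3 * (size A + size B) -> tril h T1 -> tril h T2 ->
    uniq (T1 ++ T2 ++ A ++ B) -> sorted (bl h) A -> sorted (bl h) B ->
  forces c h Psi.
Proof.
case: A => [|x A] le1 le2 t1 t2 us_ sA sB.
  by apply: (@forces_two_single _ _ _ B T1 T2); rewrite //; [move: le1|move: le2];
    rewrite /=; clear; lia.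
case: B us_ sB le2 => [|y B] us_ sB le2.
  apply: (@forces_two_single _ _ _ (x :: A) T1 T2); rewrite //.
  - by move: le1; clear; lia.
  - by move: le2; rewrite /=; clear; lia.
  by uq.
have nxy : x != y by nq.
apply: forces_ifp nxy _ _ => [|h1 e1 cxy|h1 e1 cxy]; first by move: le1; clear; lia.
  have st : brb hf h1 x [:: y] A B.
    by push_ext e1; split=> //=; rewrite ?cxy //; clear; lia.
  pose d := n + 7 * hf + 5 - (size A + size B).
  have us' : uniq ((T1 ++ T2) ++ x :: [:: y] ++ A ++ B) by uq.
  apply: (forces_seq (c2 := 24 * hf + 36) (brb_run n d st us')) => [|h2 e2].
    have : ne B <= 1 by case: (B).
    by move: le1 le2; rewrite /d /=; clear; lia.
  case=> y' [zs [us1 [ps [st' us1' sz]]]].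
  apply: (@forces_final hf n nk _ h2 _ y' zs us1 ps T1 T2); rewrite //.
  - exact: tril_ext e2 (tril_ext e1 t1).
  - exact: tril_ext e2 (tril_ext e1 t2).
  - by uq.
  by rewrite sz !size_cat /= /d; clear; lia.
push_ext e1; apply: (@forces_two_single _ _ _ (rev (x :: A) ++ y :: B) T1 T2).
- by move: le1; clear; lia.
- by move: le2; rewrite !size_cat size_rev /=; clear; lia.
- exact: tril_ext e1 t1.
- exact: tril_ext e1 t2.
- by uq.
rewrite rev_cons -cats1 -catA sorted_cat_cons -rev_cons sorted_adj_rev.
by move: sA sB => /= -> ->; rewrite cxy.
Qed.

Lemma forces_two_zigzag c h Psi (v x y : nat) (P Q T : seq nat) : 27 * hf + 39 <= c ->
    3 * n + 54 * hf + 60 <= c + 3 * (size P + size Q) -> tril h T ->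
    uniq (T ++ v :: x :: y :: P ++ Q) -> hf <= size P -> hf <= size Q ->
    path (bl h) x P -> path (bl h) y Q -> rd h v x -> rd h v y -> rd h x y ->
  forces c h Psi.
Proof.
move=> le1 le2 t us_ lP lQ pP pQ vx vy xy.
have us' : uniq (v :: x :: y :: P ++ Q) by uq.
have F := forces_zigzag_pieces n us' lP lQ pP pQ vx vy xy.
apply: (forces_seq (c2 := c - (3 * hf + 1)) F) => [|h1 e1].
  by move: le1; clear; lia.
case=> T2 [A [B [t2 sA sB mAB [lA lB]]]].
apply: (@forces_two _ _ _ A B T T2); rewrite // ?(tril_ext e1) //.
- by move: le1; clear; lia.
- by move: le1 le2 lA lB; clear; lia.
by uq.
Qed.

(** A new vertex [v] extends [P] after one round or [Q] after two. If [v x] and [v y] are both red,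
    [x y] decides: red starts a zigzag, blue joins the paths into one whose ends are joined in red,
    so that it splits at a triangle. *)
Lemma forces_one_pair c h Psi (P Q T : seq nat) : 22 * hf + 30 <= c ->
    3 * n + 51 * hf + 71 <= c + size P + 2 * size Q -> hf < size P -> hf < size Q ->
    tril h T -> uniq (T ++ P ++ Q) -> sorted (bl h) P -> sorted (bl h) Q ->
    rd h (last 0 P) (last 0 Q) ->
  forces c h Psi.
Proof.
elim/ltn_ind: c h P Q => c IH h P Q le1 le2 lP lQ t us_ sP sQ rPQ.
have [bP|bP] := leqP (n + 3 * hf + 6) (size P).
  by apply: (forces_xc_path nk Psi le1 t _ sP bP); uq.
have [bQ|bQ] := leqP (n + 3 * hf + 6) (size Q).
  by apply: (forces_xc_path nk Psi le1 t _ sQ bQ); uq.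
case: P lP le2 us_ sP rPQ bP => // x P lP le2 us_ sP rPQ bP.
case: Q lQ le2 us_ sQ rPQ bQ => // y Q lQ le2 us_ sQ rPQ bQ.
(* Both paths are still too short to close, so the invariant itself leaves enough rounds. *)
have {le1} le1 : 42 * hf + 55 <= c.
  by move: le2 bP bQ; rewrite /=; clear; lia.
have [v uv] := fresh us_.
have nvx : v != x by nq.
have nvy : v != y by nq.
have nxy : x != y by nq.
apply: forces_ifp nvx _ _ => [|h1 e1 vx|h1 e1 vx]; first by move: le1; clear; lia.
  apply: forces_ifp nvy _ _ => [|h2 e2 vy|h2 e2 vy]; first by move: le1; clear; lia.
    have red_case c' h' : extends h2 h' -> c <= c' + 3 -> rd h' x y -> forces c' h' Psi.
      move=> e' lc xy; push_ext e1; push_ext e2; push_ext e'.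
      apply: (@forces_two_zigzag _ _ _ v x y P Q T) => //.
      - by move: le1 lc; clear; lia.
      - by move: le2 lc lP lQ; rewrite /=; clear; lia.
      - exact: tril_ext e' (tril_ext e2 (tril_ext e1 t)).
      - by uq.
    have [small|big] := leqP (size P + size Q) 0.
      apply: red_case => //; first by clear; lia.
      push_ext e1; push_ext e2.
      by case: P Q small rPQ {us_ sP sQ lP lQ le2 uv bP bQ} => [|? ?] [].
    apply: forces_ifp nxy _ _ => [|h3 e3 xy|h3 e3 xy]; first by move: le1; clear; lia.
      by apply: red_case => //; clear; lia.
    push_ext e1; push_ext e2; push_ext e3.
    have {t} t := tril_ext e3 (tril_ext e2 (tril_ext e1 t)).
    have [P0 [w EP]] : exists P0 w, x :: P = rcons P0 w.
      by exists (belast x P), (last x P); rewrite lastI.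
    have sR : sorted (bl h3) (w :: rev P0 ++ y :: Q).
      rewrite -cat_cons -rev_rcons -EP rev_cons -cats1 -catA sorted_cat_cons.
      rewrite -rev_cons sorted_adj_rev.
      by move: sP sQ => /= -> ->; rewrite xy.
    have uR : uniq (T ++ w :: rev P0 ++ y :: Q) by uq.
    have szR : size P + size Q = size P0 + size Q.
      by have := congr1 size EP; rewrite size_rcons => -[->].
    have wz : rd h3 w (last y Q) by move: rPQ; rewrite EP last_rcons.
    have [bR|bR] := leqP (n + 3 * hf + 6) (size (w :: rev P0 ++ y :: Q)).
      by apply: (forces_xc_path nk Psi _ t uR sR bR); move: le1; clear; lia.
    case ER : (rev P0 ++ y :: Q) sR uR bR => [|r p] sR uR bR.
      by have := congr1 size ER; rewrite size_cat /=; clear; lia.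
    have szr : size p = size P0 + size Q.
      by have := congr1 size ER; rewrite size_cat size_rev /=; clear; lia.
    have zp : last y Q \in p.
      move: ER szr; case: (rev P0) => [|r' q] [_ <-]; last first.
        by rewrite mem_cat mem_last orbT.
      move=> E; move: big; rewrite szR -E; case: (Q) => //= z q _.
      exact: mem_last.
    have uR' : uniq (w :: r :: p) by uq.
    (* One round per vertex is affordable in place of a logarithm, since after the split each vertex
       counts for three rounds instead of one or two. *)
    have lp : size p <= 2 ^ size p by apply: ltnW; apply: ltn_expl.
    have F := @forces_split hf n (size p) h3 w r p _ uR' sR zp wz lp.
    apply: (forces_seq (c2 := c.-1.-1.-1 - size p) F) => [|h4 e4].
      by move: le2 bR; rewrite /= szr -szR; clear; lia.
    case=> T2 [A [B [t2 sA sB mAB lAB]]].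
    apply: (@forces_two _ _ _ A B T T2); rewrite // ?(tril_ext e4) //.
    - by move: le2 bR; rewrite /= szr -szR; clear; lia.
    - by move: le2 bR lAB; rewrite /= szr -szR; clear; lia.
    by uq.
  push_ext e1; push_ext e2.
  apply: (IH _ _ h2 (x :: P) (v :: y :: Q)) => //.
  - by move: le1; clear; lia.
  - by move: le1; clear; lia.
  - by move: le1 le2; rewrite /=; clear; lia.
  - by move: lQ; rewrite /=; clear; lia.
  - exact: tril_ext e2 (tril_ext e1 t).
  - by uq.
  - by rewrite /= vy.
push_ext e1; apply: (IH _ _ h1 (v :: x :: P) (y :: Q)) => //.
- by move: le1; clear; lia.
- by move: le1; clear; lia.
- by move: le1 le2; rewrite /=; clear; lia.
- by move: lP; rewrite /=; clear; lia.
- exact: tril_ext e1 t.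
- by uq.
- by rewrite /= vx.
Qed.

End Two.

Lemma fresh_seq m (s : seq nat) : uniq s -> exists F, size F = m /\ uniq (F ++ s).
Proof.
move=> us; elim: m => [|m [F [sF uF]]]; first by exists [::].
by have [v uv] := fresh uF; exists (v :: F); rewrite /= sF.
Qed.

(** * One triangle and up to three blue paths *)

Section One.

Variables (hf n : nat).
Local Notation k := (2 * hf + 3).
Local Notation forces := (forces k n).
Hypothesis nk : 8 * k <= n.

(** A blue edge from [u] to the first vertex of [Q] would put [u] in front of a path into which it
    also has a red edge, and bisection would split this path. *)
Lemma forces_probe c c' h (u : nat) (Q : seq nat) z Psi : c' < c ->
    z \in Q -> rd h u z -> uniq (u :: Q) -> sorted (bl h) Q -> size Q <= 2 ^ c' ->
    (forall h', extends h h' -> rd h' u (head 0 Q) -> forces c.-1 h' Psi) ->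
    (forall h', extends h h' -> pieces 3 (u :: Q) h' -> forces (c.-1 - c') h' Psi) ->
  forces c h Psi.
Proof.
case: Q => [|y Q] //= lc zQ uz us_ sQ lQ Fr Fp.
have c0 : 0 < c by move: lc; clear; lia.
move: zQ; rewrite in_cons => /orP[/eqP Ez|zQ].
  apply: (forces_weaken (leq_pred c)) (Fr h _ _) => //.
  by rewrite -Ez.
have nuy : u != y by move: us_; rewrite in_cons negb_or => /andP[/andP[]].
apply: forces_ifp c0 nuy Fr _ => h1 e1 uy; push_ext e1.
have sQ' : sorted (bl h1) (u :: y :: Q) by rewrite /= uy.
have F := @forces_split hf n c' h1 u y Q z us_ sQ' zQ uz (ltnW lQ).
apply: (forces_seq (c2 := c.-1 - c') F) => [|h2 e2]; first by move: lc; clear; lia.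
by apply: Fp; apply: extends_trans e1 e2.
Qed.

Lemma forces_ends c h (P : seq nat) Psi : 0 < c -> size P = n -> uniq P ->
    sorted (bl h) P ->
    (forall h', extends h h' -> rd h' (head 0 P) (last 0 P) -> forces c.-1 h' Psi) ->
  forces c h Psi.
Proof.
move=> c0 sP uP pP Fr.
have n1 : 1 < n by move: nk; clear; lia.
have neq : head 0 P != last 0 P.
  case: P sP uP {pP Fr} => [|x [|y P]] /=; rewrite ?in_cons //; try by move: n1 => /[swap] <-.
  by move=> _ /andP[nx _]; apply: contraNneq nx => ->; rewrite -in_cons mem_last.
apply: forces_ifp c0 neq Fr _ => h1 e1 xy; push_ext e1.
apply: (@forces_blue_cycle _ _ _ _ _ P) => //; first by apply: ltnW.
case: P pP xy {sP uP} => //= x P pP xy.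
by rewrite rcons_path pP blC.
Qed.

(** [F] stores the vertices joined in red to an end of [Q] until they suffice for [forces_feed]. The
    end of the new path thus has a red edge into [Q], and [forces_probe] leads to the position of
    [forces_one_pair]. *)
Lemma forces_one_single c h Psi (Q F T : seq nat) : 22 * hf + 30 <= c ->
    3 * n + 60 * hf + 82 <= c + 2 * size Q + size F -> hf < size Q ->
    size F < 3 * hf.+1 -> tril h T -> uniq (T ++ F ++ Q) -> sorted (bl h) Q ->
    (forall f, f \in F -> exists2 z, z \in Q & rd h f z) ->
  forces c h Psi.
Proof.
elim/ltn_ind: c h Q F => c IH h Q F le1 le2 lQ lF t us_ sQ FQ.
have [bQ|bQ] := leqP (n + 3 * hf + 6) (size Q).
  by apply: (forces_xc_path nk Psi le1 t _ sQ bQ); uq.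
case: Q lQ le2 us_ sQ FQ bQ => // y Q lQ le2 us_ sQ FQ bQ.
have {le1} le1 : 48 * hf + 60 + size (y :: Q) <= c.
  by move: le2 bQ lF; rewrite /=; clear; lia.
have [v uv] := fresh us_.
have nvy : v != y by nq.
apply: forces_ifp nvy _ _ => [|h1 e1 vy|h1 e1 vy]; first by move: le1; clear; lia.
  have FQ1 f : f \in v :: F -> exists2 z, z \in y :: Q & rd h1 f z.
    rewrite in_cons => /orP[/eqP->|/FQ[z zQ fz]]; last by exists z; rewrite ?(rd_ext e1).
    by exists y; rewrite ?mem_head.
  push_ext e1; have {}t := tril_ext e1 t.
  have [lF'|bF] := ltnP (size F).+1 (3 * hf.+1).
    apply: (IH _ _ h1 (y :: Q) (v :: F)) => //.
    - by move: le1; clear; lia.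
    - by move: le1; clear; lia.
    - by move: le1 le2; rewrite /=; clear; lia.
    by uq.
  have uF : uniq (v :: F) by uq.
  have sF : size (v :: F) = 3 * hf.+1 by move: lF bF; rewrite /=; clear; lia.
  have Fd := @forces_feed hf n h1 (v :: F) uF sF.
  apply: (forces_seq (c2 := c.-1 - (7 * hf + 8)) Fd) => [|h2 e2].
    by move: le1; clear; lia.
  push_ext e2; have {}t := tril_ext e2 t.
  case=> [[P [sP lP mP]]|[a [b [d [tr mT]]]]]; last first.
    apply: (@forces_two _ _ nk _ _ _ (y :: Q) [::] T [:: a; b; d]) => //.
    - by move: le1; clear; lia.
    - by move: le1 le2 lF lQ; rewrite /=; clear; lia.
    by uq.
  have [P0 [u EP]] : exists P0 u, P = rcons P0 u.
    by case: (P) lP => // p P' _; exists (belast p P'), (last p P'); rewrite lastI.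
  have [z zQ uz] : exists2 z, z \in y :: Q & rd h2 u z.
    have uF' : u \in v :: F.
      have := mP u; rewrite EP -cats1 count_cat -[u \in _]has_pred1 has_count.
      by rewrite [count_mem u [:: u]]/= eqxx; clear; lia.
    by have [z zQ uz] := FQ1 _ uF'; exists z; rewrite ?(rd_ext e2).
  have uuQ : uniq (u :: y :: Q) by uq.
  apply: (@forces_probe _ (size (y :: Q)) _ u (y :: Q) z) => //.
  - by move: le1; clear; lia.
  - by apply: ltnW; apply: ltn_expl.
  - move=> h3 e3 uy; push_ext e3.
    apply: (@forces_one_pair _ _ nk _ _ _ P (rev (y :: Q)) T).
    + by move: le1; clear; lia.
    + by move: le1 le2 lF lP; rewrite size_rev /=; clear; lia.
    + by [].
    + by rewrite size_rev.
    + exact: tril_ext e3 t.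
    + by uq.
    + by [].
    + by rewrite sorted_adj_rev.
    by rewrite EP last_rcons rev_cons last_rcons.
  move=> h3 e3 [T2 [A [B [t2 sA sB mAB lAB]]]].
  apply: (@forces_two _ _ nk _ _ _ A B T T2); rewrite // ?(tril_ext e3) //.
  - by move: le1 le2 bQ lF; rewrite /=; clear; lia.
  - by move: le1 le2 lAB lF bQ; rewrite /=; clear; lia.
  by uq.
push_ext e1; apply: (IH _ _ h1 (v :: y :: Q) F) => //.
- by move: le1; clear; lia.
- by move: le1; clear; lia.
- by move: le1 le2; rewrite /=; clear; lia.
- by move: lQ; rewrite /=; clear; lia.
- exact: tril_ext e1 t.
- by uq.
- by rewrite /= vy.
by move=> f /FQ[z zQ fz]; exists z; rewrite ?(rd_ext e1) // in_cons zQ orbT.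
Qed.

Lemma forces_one_fresh c h Psi (T : seq nat) : 3 * n + 65 * hf + 88 <= c ->
  tril h T -> uniq T -> forces c h Psi.
Proof.
move=> le1 t uT; have [F [sF uFT]] := fresh_seq (3 * hf.+1) uT.
have uF : uniq F by uq.
have Fd := @forces_feed hf n h F uF sF.
apply: (forces_seq (c2 := c - (7 * hf + 8)) Fd) => [|h2 e2].
  by move: le1; clear; lia.
have {}t := tril_ext e2 t.
case=> [[P [sP lP mP]]|[a [b [d [tr mT]]]]].
  apply: (@forces_one_single _ _ _ P [::] T) => //.
  - by move: le1; clear; lia.
  - by move: le1 lP; rewrite /=; clear; lia.
  by uq.
apply: (@forces_two _ _ nk _ _ _ [::] [::] T [:: a; b; d]) => //.
- by move: le1; clear; lia.
- by move: le1; rewrite /=; clear; lia.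
by uq.
Qed.

Lemma forces_one c h Psi (A B T : seq nat) : 22 * hf + 31 <= c ->
    3 * n + 68 * hf + 88 <= c + size A + 2 * size B -> tril h T ->
    uniq (T ++ A ++ B) -> sorted (bl h) A -> sorted (bl h) B -> forces c h Psi.
Proof.
move=> le1 le2 t us_ sA sB.
have [smA|lA] := leqP (size A) hf; have [smB|lB] := leqP (size B) hf.
- by apply: forces_one_fresh t _; [move: le1 le2 smA smB; clear; lia | uq].
- apply: (@forces_one_single _ _ _ B [::] T) => //.
  + by move: le1; clear; lia.
  + by move: le2 smA; rewrite /=; clear; lia.
  by uq.
- apply: (@forces_one_single _ _ _ A [::] T) => //.
  + by move: le1; clear; lia.
  + by move: le2 lA smB; rewrite /=; clear; lia.
  by uq.
have [A0 [x EA]] : exists A0 x, A = rcons A0 x.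
  by case: (A) lA => // p P' _; exists (belast p P'), (last p P'); rewrite lastI.
have [B0 [y EB]] : exists B0 y, B = rcons B0 y.
  by case: (B) lB => // p P' _; exists (belast p P'), (last p P'); rewrite lastI.
have nxy : x != y by nq.
apply: forces_ifp nxy _ _ => [|h1 e1 xy|h1 e1 xy]; first by move: le1; clear; lia.
  push_ext e1; apply: (@forces_one_pair _ _ nk _ _ _ A B T) => //.
  - by move: le1; clear; lia.
  - by move: le1 le2; clear; lia.
  - exact: tril_ext e1 t.
  by rewrite EA EB !last_rcons.
push_ext e1; apply: (@forces_one_single _ _ _ (A ++ rev B) [::] T) => //.
- by move: le1; clear; lia.
- by move: le1 le2 lA lB; rewrite size_cat size_rev /=; clear; lia.
- by rewrite size_cat; move: lA; clear; lia.
- exact: tril_ext e1 t.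
- by uq.
rewrite EA EB rev_rcons sorted_cat_cons.
have sBr : sorted (bl h1) (y :: rev B0) by rewrite -rev_rcons sorted_adj_rev -EB.
move: sBr => /= ->; rewrite andbT -cats1 cat_rcons sorted_cat_cons -EA sA /=.
by rewrite xy.
Qed.

(** A blue edge among the three first vertices joins two paths. If all are red, the first vertex of
    [P] and the zigzag between [A] and [B] give a second triangle; then the rest of [P] and the
    longer remainder suffice, since three times the longer one exceeds the sum of both. *)
Lemma forces_three c h Psi (P A B T : seq nat) : 27 * hf + 42 <= c ->
    3 * n + 69 * hf + 91 <= c + size A + size B + 2 * size P -> tril h T ->
    uniq (T ++ P ++ A ++ B) ->
    sorted (bl h) P -> sorted (bl h) A -> sorted (bl h) B -> forces c h Psi.
Proof.
move=> le1 le2 t us_ sP sA sB.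
have [smA|lA] := leqP (size A) hf.
  apply: (@forces_one _ _ _ B P T) => //; last by uq.
    by move: le1; clear; lia.
  by move: le2 smA; clear; lia.
have [smB|lB] := leqP (size B) hf.
  apply: (@forces_one _ _ _ A P T) => //; last by uq.
    by move: le1; clear; lia.
  by move: le2 smB; clear; lia.
case: P le2 us_ sP => [|u P] le2 us_ sP.
  apply: (@forces_one _ _ _ A B T) => //.
    by move: le1; clear; lia.
  by move: le2; rewrite /=; clear; lia.
have join h' (x y : nat) (X Y : seq nat) : sorted (bl h') (x :: X) ->
    sorted (bl h') (y :: Y) -> bl h' x y -> sorted (bl h') (rev (x :: X) ++ y :: Y).
  move=> sX sY xy; rewrite rev_cons -cats1 -catA sorted_cat_cons -rev_cons.
  by rewrite sorted_adj_rev; move: sX sY => /= -> ->; rewrite xy.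
case: A lA le2 us_ sA => // x A lA le2 us_ sA.
case: B lB le2 us_ sB => // y B lB le2 us_ sB.
have nxy : x != y by nq.
have nux : u != x by nq.
have nuy : u != y by nq.
apply: forces_ifp nxy _ _ => [|h1 e1 xy|h1 e1 xy]; first by move: le1; clear; lia.
  apply: forces_ifp nux _ _ => [|h2 e2 ux|h2 e2 ux]; first by move: le1; clear; lia.
    apply: forces_ifp nuy _ _ => [|h3 e3 uy|h3 e3 uy]; first by move: le1; clear; lia.
      push_ext e1; push_ext e2; push_ext e3.
      have {t} t := tril_ext e3 (tril_ext e2 (tril_ext e1 t)).
      have us' : uniq (u :: x :: y :: A ++ B) by uq.
      have F := forces_zigzag_pieces n us' lA lB sA sB ux uy xy.
      apply: (forces_seq (c2 := c.-1.-1.-1 - (3 * hf + 1)) F) => [|h4 e4].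
        by move: le1; clear; lia.
      push_ext e4; have {}t := tril_ext e4 t.
      case=> T2 [A' [B' [t2 sA' sB' mAB [lA' lB']]]].
      have sP' : sorted (bl h4) P := path_sorted sP.
      have [leAB|leBA] := leqP (size B') (size A').
        apply: (@forces_two _ _ nk _ _ _ P A' T T2) => //.
        - by move: le1; clear; lia.
        - by move: le1 le2 lA' lB' leAB; rewrite /=; clear; lia.
        by uq.
      apply: (@forces_two _ _ nk _ _ _ P B' T T2) => //.
      - by move: le1; clear; lia.
      - by move: le1 le2 lA' lB' leBA; rewrite /=; clear; lia.
      by uq.
    push_ext e1; push_ext e2; push_ext e3.
    apply: (@forces_one _ _ _ (x :: A) (rev (u :: P) ++ y :: B) T) => //.
    - by move: le1; clear; lia.
    - by move: le1 le2; rewrite size_cat size_rev /=; clear; lia.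
    - exact: tril_ext e3 (tril_ext e2 (tril_ext e1 t)).
    - by uq.
    exact: join.
  push_ext e1; push_ext e2.
  apply: (@forces_one _ _ _ (y :: B) (rev (u :: P) ++ x :: A) T) => //.
  - by move: le1; clear; lia.
  - by move: le1 le2; rewrite size_cat size_rev /=; clear; lia.
  - exact: tril_ext e2 (tril_ext e1 t).
  - by uq.
  exact: join.
push_ext e1.
apply: (@forces_one _ _ _ (rev (x :: A) ++ y :: B) (u :: P) T) => //.
- by move: le1; clear; lia.
- by move: le1 le2; rewrite size_cat size_rev /=; clear; lia.
- exact: tril_ext e1 t.
- by uq.
exact: join.
Qed.

End One.

(** * No triangle yet: the logarithmic term *)

Section Zero.

Variables (hf n L : nat).
Local Notation k := (2 * hf + 3).
Local Notation forces := (forces k n).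
Hypothesis nk : 8 * k <= n.
Hypothesis nL : n <= 2 ^ L.

Lemma forces_zero_zigzag c h Psi (v x y : nat) (P Q : seq nat) : 25 * hf + 32 <= c ->
    3 * n + 74 * hf + 89 <= c + size Q + 2 * size P ->
    uniq (v :: x :: y :: P ++ Q) -> hf <= size P -> hf <= size Q ->
    path (bl h) x P -> path (bl h) y Q -> rd h v x -> rd h v y -> rd h x y ->
  forces c h Psi.
Proof.
move=> le1 le2 us_ lP lQ pP pQ vx vy xy.
have F := forces_zigzag_pieces n us_ lP lQ pP pQ vx vy xy.
apply: (forces_seq (c2 := c - (3 * hf + 1)) F) => [|h1 e1].
  by move: le1; clear; lia.
case=> T [A [B [t sA sB mAB [lA lB]]]].
apply: (@forces_one _ _ nk _ _ _ B A T) => //.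
- by move: le1; clear; lia.
- by move: le1 le2 lA lB; clear; lia.
by uq.
Qed.

Lemma forces_zero_three c h Psi (P : seq nat) (s : seq nat) : 27 * hf + 42 <= c ->
    3 * n + 69 * hf + 94 <= c + size s + 2 * size P -> pieces 3 s h ->
    uniq (s ++ P) -> sorted (bl h) P -> forces c h Psi.
Proof.
move=> le1 le2 [T [A [B [t sA sB mAB lAB]]]] us_ sP.
apply: (@forces_three _ _ nk _ _ _ P A B T) => //; last by uq.
by move: le2 lAB; clear; lia.
Qed.

(** [Q] may be split and [P] is kept whole up to one end vertex, as [forces_three] counts split
    pieces once and the intact path twice. The red edges from both ends of [P] into [Q] prepare the
    probes. *)
Lemma forces_zero_pair c h Psi (Q P : seq nat) :
    3 * n + 74 * hf + 100 + L <= c + size Q + 2 * size P ->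
    hf < size Q <= n -> hf < size P <= n -> uniq (Q ++ P) ->
    sorted (bl h) Q -> sorted (bl h) P ->
    (exists2 z, z \in Q & rd h (head 0 P) z) ->
    (exists2 z, z \in Q & rd h (last 0 P) z) ->
  forces c h Psi.
Proof.
elim/ltn_ind: c h Q P => c IH h Q P le2 /andP[lQ mQ] /andP[lP mP] us_ sQ sP rx rx0.
have le1 : 74 * hf + 100 + L <= c by move: le2 mQ mP; clear; lia.
have [EQ|nQ] := eqVneq (size Q) n.
  have uQ : uniq Q by uq.
  apply: (forces_ends nk _ EQ uQ sQ) => [|h1 e1]; first by move: le1; clear; lia.
  push_ext e1; have [y [y2 [p def_Q]]] : exists y y2 p, Q = [:: y, y2 & p].
    case: (Q) EQ => [|y [|y2 p]] EQ; try by move: nk EQ; rewrite /=; clear; lia.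
    by exists y, y2, p.
  subst Q => yl.
  have zp : last y2 p \in p.
    by case: (p) EQ => [|z q] E; [move: nk E; rewrite /=; clear; lia | exact: mem_last].
  have lp : size p <= 2 ^ L by move: nL EQ; rewrite /=; clear; lia.
  have F := @forces_split hf n L h1 y y2 p (last y2 p) uQ sQ zp yl lp.
  apply: (forces_seq (c2 := c.-1 - L) F) => [|h2 e2 pcs]; first by move: le1; clear; lia.
  push_ext e2; apply: (@forces_zero_three _ _ _ P _ _ _ pcs) => //.
  - by move: le1; clear; lia.
  - by move: le1 le2; rewrite /=; clear; lia.
case: Q lQ mQ us_ sQ rx rx0 le2 nQ => // y Q lQ mQ us_ sQ rx rx0 le2 nQ.
have lQL : size (y :: Q) <= 2 ^ L by apply: leq_trans mQ nL.
(* With [n] vertices on [P], its ends [x], [x0] are joined in red. If both are also red to [y], then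
   [x0] takes the place of [v] in the zigzag; otherwise a probe splits [Q] at the cost of one end of
   [P]. *)
have [EP|nP] := eqVneq (size P) n.
  have uP : uniq P by uq.
  apply: (forces_ends nk _ EP uP sP) => [|h1 e1]; first by move: le1; clear; lia.
  push_ext e1; have [x [P2 [x0 def_P]]] : exists x P2 x0, P = x :: rcons P2 x0.
    case: (P) EP => [|x P1] EP; first by move: nk EP; rewrite /=; clear; lia.
    case: (lastP P1) EP => [|P2 x0] EP; last by exists x, P2, x0.
    by move: nk EP; rewrite /=; clear; lia.
  subst P; move: rx0 EP le2; rewrite /= last_rcons size_rcons => rx0 EP le2 xx0.
  have us1 : uniq (x :: y :: Q) by uq.
  have us2 : uniq (x0 :: y :: Q) by uq.
  have nP2 : n = (size P2).+2 by rewrite EP.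
  have sP2 : path (bl h1) x P2 by move: sP; rewrite /= rcons_path => /andP[].
  case: rx => z zQ xz; push_ext e1.
  apply: (@forces_probe _ _ _ L _ x (y :: Q) z) => //.
  - by move: le1; clear; lia.
  - move=> h2 e2 xy; push_ext e2; case: rx0 => z0 zQ0 x0z; push_ext e1; push_ext e2.
    apply: (@forces_probe _ _ _ L _ x0 (y :: Q) z0) => //.
    + by move: le1; clear; lia.
    + move=> h3 e3 x0y; push_ext e3.
      apply: (@forces_zero_zigzag _ _ _ x0 x y P2 Q) => //.
      * by move: le1; clear; lia.
      * by move: le1 le2 nP2; rewrite /=; clear; lia.
      * by uq.
      * by move: nk nP2; clear; lia.
      * by rewrite rdC.
    move=> h3 e3 pcs; push_ext e3.
    apply: (@forces_zero_three _ _ _ (x :: P2) _ _ _ pcs) => //.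
    + by move: le1; clear; lia.
    + by move: le1 le2 nP2; rewrite /=; clear; lia.
    by uq.
  move=> h2 e2 pcs; push_ext e2.
  apply: (@forces_zero_three _ _ _ (rcons P2 x0) _ _ _ pcs) => //.
  - by move: le1; clear; lia.
  - by move: le1 le2 nP2; rewrite /= size_rcons; clear; lia.
  - by uq.
  exact: path_sorted sP.
have {nQ} mQ' : size (y :: Q) < n by rewrite ltn_neqAle nQ.
have {nP} mP' : size P < n by rewrite ltn_neqAle nP.
case: P lP mP us_ sP rx rx0 le2 mP' => // x P lP mP us_ sP rx rx0 le2 mP'.
have [v uv] := fresh us_.
have nvx : v != x by nq.
have nvy : v != y by nq.
apply: forces_ifp nvy _ _ => [|h1 e1 vy|h1 e1 vy]; first by move: le1; clear; lia.
  apply: forces_ifp nvx _ _ => [|h2 e2 vx|h2 e2 vx]; first by move: le1; clear; lia.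
    have us1 : uniq (x :: y :: Q) by uq.
    case: rx => z zQ xz; push_ext e1; push_ext e2.
    apply: (@forces_probe _ _ _ L _ x (y :: Q) z) => //.
    - by move: le1; clear; lia.
    - move=> h3 e3 xy; push_ext e3.
      apply: (@forces_zero_zigzag _ _ _ v x y P Q) => //.
      + by move: le1; clear; lia.
      + by move: le1 le2; rewrite /=; clear; lia.
      by uq.
    move=> h3 e3 pcs; push_ext e3.
    apply: (@forces_zero_three _ _ _ P _ _ _ pcs) => //.
    - by move: le1; clear; lia.
    - by move: le1 le2; rewrite /=; clear; lia.
    - by uq.
    exact: path_sorted sP.
  push_ext e1; push_ext e2; apply: (IH _ _ h2 (y :: Q) (v :: x :: P)) => //.
  - by move: le1; clear; lia.
  - by move: le1 le2; rewrite /=; clear; lia.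
  - by rewrite lQ.
  - by move: lP mP'; rewrite /=; clear; lia.
  - by uq.
  - by rewrite /= vx.
  - by exists y; rewrite ?mem_head.
  by case: rx0 => z zQ xz; push_ext e1; push_ext e2; exists z.
push_ext e1; apply: (IH _ _ h1 (v :: y :: Q) (x :: P)) => //.
- by move: le1; clear; lia.
- by move: le1 le2; rewrite /=; clear; lia.
- by move: lQ mQ'; rewrite /=; clear; lia.
- by rewrite lP.
- by rewrite /= vy.
- by case: rx => z zQ xz; push_ext e1; exists z; rewrite // in_cons zQ orbT.
by case: rx0 => z zQ xz; push_ext e1; exists z; rewrite // in_cons zQ orbT.
Qed.

(** As in [forces_one_single], but a vertex of [Q] counts for one round only, and [Q] is split at
    [n] vertices for [L] rounds. *)
Lemma forces_zero_single c h Psi (Q F : seq nat) :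
    3 * n + 82 * hf + 109 + L <= c + size Q + size F ->
    hf < size Q <= n -> size F < 3 * hf.+1 -> uniq (F ++ Q) -> sorted (bl h) Q ->
    (forall f, f \in F -> exists2 z, z \in Q & rd h f z) ->
  forces c h Psi.
Proof.
elim/ltn_ind: c h Q F => c IH h Q F le2 /andP[lQ mQ] lF us_ sQ FQ.
have le1 : 79 * hf + 107 + L + n <= c by move: le2 mQ lF; clear; lia.
have [EQ|nQ] := eqVneq (size Q) n.
  have uQ : uniq Q by uq.
  apply: (forces_ends nk _ EQ uQ sQ) => [|h1 e1]; first by move: le1; clear; lia.
  push_ext e1; have [y [y2 [p def_Q]]] : exists y y2 p, Q = [:: y, y2 & p].
    case: (Q) EQ => [|y [|y2 p]] EQ; try by move: nk EQ; rewrite /=; clear; lia.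
    by exists y, y2, p.
  subst Q => yl.
  have zp : last y2 p \in p.
    by case: (p) EQ => [|z q] E; [move: nk E; rewrite /=; clear; lia | exact: mem_last].
  have lp : size p <= 2 ^ L by move: nL EQ; rewrite /=; clear; lia.
  have F1 := @forces_split hf n L h1 y y2 p (last y2 p) uQ sQ zp yl lp.
  apply: (forces_seq (c2 := c.-1 - L) F1) => [|h2 e2 pcs]; first by move: le1; clear; lia.
  push_ext e2; case: pcs => T [A [B [t sA sB mAB lAB]]].
  apply: (@forces_three _ _ nk _ _ _ [::] A B T) => //; last by uq.
  - by move: le1; clear; lia.
  - by move: le1 le2 lAB lF EQ; rewrite /=; clear; lia.
case: Q lQ mQ us_ sQ FQ le2 nQ => // y Q lQ mQ us_ sQ FQ le2 nQ.
have {nQ} mQ' : size (y :: Q) < n by rewrite ltn_neqAle nQ.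
have [v uv] := fresh us_.
have nvy : v != y by nq.
apply: forces_ifp nvy _ _ => [|h1 e1 vy|h1 e1 vy]; first by move: le1; clear; lia.
  have FQ1 f : f \in v :: F -> exists2 z, z \in y :: Q & rd h1 f z.
    rewrite in_cons => /orP[/eqP->|/FQ[z zQ fz]]; last by exists z; rewrite ?(rd_ext e1).
    by exists y; rewrite ?mem_head.
  push_ext e1; have [lF'|bF] := ltnP (size F).+1 (3 * hf.+1).
    apply: (IH _ _ h1 (y :: Q) (v :: F)) => //.
    - by move: le1; clear; lia.
    - by move: le1 le2; rewrite /=; clear; lia.
    - by rewrite lQ.
  have uF : uniq (v :: F) by uq.
  have sF : size (v :: F) = 3 * hf.+1 by move: lF bF; rewrite /=; clear; lia.
  have Fd := @forces_feed hf n h1 (v :: F) uF sF.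
  apply: (forces_seq (c2 := c.-1 - (7 * hf + 8)) Fd) => [|h2 e2].
    by move: le1; clear; lia.
  push_ext e2; case=> [[P [sP lP mP]]|[a [b [d [tr mT]]]]]; last first.
    apply: (@forces_one _ _ nk _ _ _ [::] (y :: Q) [:: a; b; d]) => //.
    - by move: le1; clear; lia.
    - by move: le1 le2 lF lQ; rewrite /=; clear; lia.
    by uq.
  have PQ u : u \in P -> exists2 z, z \in y :: Q & rd h2 u z.
    move=> uP; have uF' : u \in v :: F.
      move: uP; have := mP u; rewrite -!has_pred1 !has_count; clear; lia.
    by have [z zQ uz] := FQ1 _ uF'; exists z; rewrite ?(rd_ext e2).
  have uP : uniq P by uq.
  have szP : size P <= 3 * hf.+1.
    rewrite -sF; apply: uniq_leq_size uP _ => u; have := mP u.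
    by rewrite -!has_pred1 !has_count; clear; lia.
  apply: (@forces_zero_pair _ _ _ (y :: Q) P) => //.
  - by move: le1 le2 lF lP; rewrite /=; clear; lia.
  - by rewrite lQ.
  - by move: lP szP nk; clear; lia.
  - by uq.
  - by apply: PQ; case: (P) lP => //= p P' _; rewrite mem_head.
  by apply: PQ; case: (P) lP => //= p P' _; rewrite mem_last.
push_ext e1; apply: (IH _ _ h1 (v :: y :: Q) F) => //.
- by move: le1; clear; lia.
- by move: le1 le2; rewrite /=; clear; lia.
- by move: lQ mQ'; rewrite /=; clear; lia.
- by uq.
- by rewrite /= vy.
by move=> f /FQ[z zQ fz]; exists z; rewrite ?(rd_ext e1) // in_cons zQ orbT.
Qed.

Lemma forces_start c h Psi : 3 * n + 88 * hf + 116 + L <= c -> forces c h Psi.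
Proof.
move=> le1; have [F [sF]] := fresh_seq (3 * hf.+1) (isT : uniq [::]).
rewrite cats0 => uF; have Fd := @forces_feed hf n h F uF sF.
apply: (forces_seq (c2 := c - (7 * hf + 8)) Fd) => [|h2 e2].
  by move: le1; clear; lia.
case=> [[P [sP lP mP]]|[a [b [d [tr mT]]]]].
  have uP : uniq P by uq.
  have szP : size P <= 3 * hf.+1.
    rewrite -sF; apply: uniq_leq_size uP _ => u; have := mP u.
    by rewrite -!has_pred1 !has_count; clear; lia.
  apply: (@forces_zero_single _ _ _ P [::]) => //.
  - by move: le1 lP; rewrite /=; clear; lia.
  - by move: lP szP nk; clear; lia.
apply: (@forces_one_fresh _ _ nk _ _ _ [:: a; b; d]) => //; last by uq.
by move: le1; clear; lia.
Qed.

End Zero.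

(** * From winning positions to a strategy of Builder, and the final bound *)

Lemma ex_least (P : nat -> Prop) c : P c ->
  exists m, [/\ P m, m <= c & forall m', P m' -> m <= m'].
Proof.
elim/ltn_ind: c => c IH Pc; have [[m [lm Pm]]|H] := EM (exists m, m < c /\ P m).
  by have [m' [Pm' lm' min]] := IH m lm Pm; exists m'; split=> //; move: lm lm'; lia.
by exists c; split=> // m' Pm'; rewrite leqNgt; apply/negP => lm; apply: H; exists m'.
Qed.

Lemma fresh_edge (h : history) : exists e, e \notin unzip1 h.
Proof.
pose s := map (fun e : KNedge => (val e).2) (unzip1 h).
have [v] := fresh (undup_uniq (0 :: s)).
rewrite cons_uniq mem_undup in_cons negb_or => /andP[/andP[v0 vh] _].
have lt0v : (0, v).1 < (0, v).2 by rewrite lt0n.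
exists (exist (fun e : nat * nat => e.1 < e.2) (0, v) lt0v).
by apply: contra vh => he; apply/mapP; exists (exist _ (0, v) lt0v).
Qed.

(** The move chosen at [h] belongs to the least [r] with [winning G1 G2 r h] and so serves every
    larger [r]; elsewhere any unselected edge keeps [b] legal. *)
Lemma winning_builder G1 G2 c : winning G1 G2 c [::] -> builder_ends_within G1 G2 c.
Proof.
move=> W.
have good h : exists e, e \notin unzip1 h /\ forall r, winning G1 G2 r.+1 h ->
    game_over G1 G2 h \/ forall col, winning G1 G2 r ((e, col) :: h).
  have [e0 he0] := fresh_edge h.
  have [over|nover] := EM (game_over G1 G2 h); first by exists e0; split=> // r _; left.
  have [[r Wr]|nW] := EM (exists r, winning G1 G2 r h); last first.
    by exists e0; split=> // r Wr; case: nW; exists r.+1.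
  have [[|m] [Wm _ min]] := @ex_least (fun r => winning G1 G2 r h) _ Wr; first by case: Wm.
  case: Wm => [//|[e he He]]; exists e; split=> // r' /min lt_r; right=> col.
  exact: (@winning_leq _ _ m r' _ lt_r (He col)).
have [b Hb] := choice good; exists b; split=> [h|p]; first by have [] := Hb h.
suff end_from r m : winning G1 G2 r (play b p m) ->
    exists2 m', m' <= m + r & game_over G1 G2 (play b p m').
  exact: (end_from c 0 W).
elim: r m => [|r IH] m Wm; first by case: Wm => // over; exists m; rewrite ?leq_addr.
have [_ /(_ r Wm) [over|Wn]] := Hb (play b p m); first by exists m; rewrite ?leq_addr.
by rewrite addnS -addSn; apply: IH; apply: Wn.
Qed.

Lemma trunc_log_le_log2 (R : realType) n : 0 < n ->
  ((trunc_log 2 n)%:R <= log2 n%:R :> R)%R.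
Proof.
move=> n0; have ln2 : (0 < ln 2 :> R)%R by rewrite ln_gt0 // ltr1n.
rewrite /log2 ler_pdivlMr // mulr_natl -lnXn ?ltr0n // -natrX.
by rewrite ler_ln ?posrE ?ltr0n ?expn_gt0 // ler_nat trunc_logP.
Qed.

Theorem theorem2 (R : realType) (k n : nat)
    (hk : 3 <= k) (k_odd : odd k) (hn : 8 * k <= n) :
  exists r : nat, is_online_ramsey (cycle_graph k) (cycle_graph n) r /\
    (r%:R <= 3 * n%:R + log2 n%:R + 50 * k%:R :> R)%R.
Proof.
have n0 : 0 < n by apply: leq_trans hn; rewrite muln_gt0 (leq_trans _ hk).
have [hf Ek] : exists hf, k = 2 * hf + 3.
  by exists (k - 3)./2; move: hk k_odd; clear; lia.
pose c := 3 * n + 88 * hf + 116 + (trunc_log 2 n).+1.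
have W : winning (cycle_graph k) (cycle_graph n) (c + 0) [::].
  rewrite Ek in hn *; have nL : n <= 2 ^ (trunc_log 2 n).+1.
    by rewrite ltnW // trunc_log_ltn.
  have [F] := @forces_start hf n _ hn nL c [::] (fun=> False) (leqnn _).
  exact: F.
rewrite addn0 in W.
have [r [end_r le_rc min]] := @ex_least (builder_ends_within _ _) _ (winning_builder W).
exists r; split=> //.
(* [50 * k = 100 * hf + 150] covers [88 * hf + 117], the last unit coming from rounding the
   logarithm up. *)
have le_c : c <= 3 * n + trunc_log 2 n + 50 * k by rewrite /c Ek; clear; lia.
apply: le_trans (_ : ((3 * n + trunc_log 2 n + 50 * k)%N%:R <= _)%R).
  by rewrite ler_nat (leq_trans le_rc).
rewrite (natrD _ (_ + _)%N) (natrD _ (3 * n)%N) !natrM lerD2r lerD2l.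
exact: trunc_log_le_log2.
Qed.
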